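(* Assume the $\tau$-periodic system described in the context is exponentially stable, and let $y_{ref}\in L^2_{loc}(0,\infty;Y_0)$ and $w_{dist}\in L^2_{loc}(0,\infty;U_{d0})$ be given $\tau$-periodic functions. If there exists $u_{reg}\in L^2(0,\tau;U_0)$ such that $$\mathcal{P}u_{reg}=y_{ref}-\mathcal{P}_d w_{dist}\qquad (\ast)$$ (an identity in $L^2(0,\tau;Y_0)$, where $y_{ref}$ and $w_{dist}$ are restricted to $[0,\tau]$), then the control input $u\in L^2_{loc}(0,\infty;U_0)$ that is the $\tau$-periodic extension of $u_{reg}$ from $[0,\tau]$ to $[0,\infty)$ solves the feedforward output regulation problem, i.e., there exist $M,\alpha>0$ such that $$\int_{n\tau}^{(n+1)\tau}\|y(t)-y_{ref}(t)\|^2\,dt\le M^2e^{-2\alpha n}\left(\|x_0\|^2+1\right)$$ for all $x_0\in X$ and all integers $n\ge 0$. Conversely, if $u_{reg}\in L^2_{loc}(0,\infty;U_0)$ is a $\tau$-periodic control input such that the output $y$ of the system (with initial state $x_0\in X$, input $u=u_{reg}$ and disturbance $w_{dist}$) satisfies $\|y(n\tau+\cdot)-y_{ref}(\cdot)\|_{L^2(0,\tau;Y_0)}\to 0$ as $n\to\infty$, then $u_{reg}$ satisfies $(\ast)$ on $[0,\tau]$.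
   Context: Let $\tau>0$, let $X$ be a Banach space (the state space) and let $U_0$, $U_{d0}$, $Y_0$ be Hilbert spaces. Consider the system $$\dot x(t)=A(t)x(t)+B(t)u(t)+B_d(t)w_{dist}(t),\quad x(0)=x_0\in X,\qquad y(t)=C(t)x(t)+D(t)u(t),$$ where $A(\cdot),B(\cdot),B_d(\cdot),C(\cdot),D(\cdot)$ are $\tau$-periodic operator-valued functions with $B\in L^\infty(\mathbb{R},\mathcal{L}(U_0,X))$, $B_d\in L^\infty(\mathbb{R},\mathcal{L}(U_{d0},X))$, $C\in L^\infty(\mathbb{R},\mathcal{L}(X,Y_0))$, $D\in L^\infty(\mathbb{R},\mathcal{L}(U_0,Y_0))$. It is assumed that $A(\cdot)$ determines a strongly continuous evolution family $(U_A(t,s))_{t\ge s}\subset\mathcal{L}(X)$: $U_A(t,t)=I$, $U_A(t,r)U_A(r,s)=U_A(t,s)$ for $t\ge r\ge s$, $(t,s)\mapsto U_A(t,s)x$ is continuous for every $x\in X$, and $U_A(t+\tau,s+\tau)=U_A(t,s)$ by periodicity. The state of the system is the mild state $$x(t)=U_A(t,0)x_0+\int_0^tU_A(t,s)\big(B(s)u(s)+B_d(s)w_{dist}(s)\big)ds.$$ The system is exponentially stable if there exist $M,\omega>0$ such that $\|U_A(t,s)\|\le Me^{-\omega(t-s)}$ for all $t\ge s$; in this case $I-U_A(\tau,0)$ is boundedly invertible. Denote $G_A(t,s)=U_A(t,0)(I-U_A(\tau,0))^{-1}U_A(\tau,s)$. The operators $\mathcal{P}\in\mathcal{L}(L^2(0,\tau;U_0),L^2(0,\tau;Y_0))$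 and $\mathcal{P}_d\in\mathcal{L}(L^2(0,\tau;U_{d0}),L^2(0,\tau;Y_0))$ are defined for $t\in[0,\tau]$ by $$(\mathcal{P}u)(t)=C(t)\int_0^\tau G_A(t,s)B(s)u(s)ds+C(t)\int_0^tU_A(t,s)B(s)u(s)ds+D(t)u(t),$$ $$(\mathcal{P}_dw)(t)=C(t)\int_0^\tau G_A(t,s)B_d(s)w(s)ds+C(t)\int_0^tU_A(t,s)B_d(s)w(s)ds.$$ *)

(* Defs.v *)
From HB Require Import structures.
From mathcomp Require Import all_boot all_order all_algebra.
From mathcomp Require Import all_classical all_reals all_analysis.
From mathcomp Require Import sesquilinear.

Set Implicit Arguments.
Unset Strict Implicit.
Unset Printing Implicit Defensive.

Import Order.TTheory GRing.Theory Num.Theory.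
Import numFieldNormedType.Exports.

Local Open Scope classical_set_scope.
Local Open Scope ring_scope.

(* Scalars are real throughout. Complex Banach and Hilbert spaces are covered
   by restriction of scalars: a complex space with its norm is a real one (with
   the real part of the inner product), complex-linear operators are
   real-linear, and the integrals, norms and inverses below do not change. *)

Definition hilbert (R : realType) (V : completeNormedModType R) : Prop :=
  exists ip : {dot V for (@idfun R)}, forall v : V, `|v| ^+ 2 = ip v v.

Section operators.
Context {R : realType} {V W : normedModType R}.

Definition bounded_op (T : V -> W) : Prop := linear T /\ continuous T.

Definition opnorm (T : V -> W) : R :=
  sup [set `|T v| | v in [set v : V | `|v| <= 1]].

End operators.

Section bochner.
Context {d : measure_display} {T : measurableType d} {R : realType}.
Variable mu : {measure set T -> \bar R}.

Definition simple_fun (V : Type) (h : T -> V) : Prop :=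
  finite_set (range h) /\ forall v : V, measurable (h @^-1` [set v]).

Section vector_valued.
Context {V : normedModType R}.

Definition strongly_measurable (D : set T) (f : T -> V) : Prop :=
  exists h : nat -> T -> V, (forall n, simple_fun (h n)) /\
    {ae mu, forall t, D t -> h n t @[n --> \oo] --> f t}.

(* Only the (finitely many) values taken by [h] contribute to the sum. *)
Definition simple_integral (D : set T) (h : T -> V) : V :=
  \sum_(v \in [set: V]) fine (mu (D `&` h @^-1` [set v])) *: v.

Definition has_bochner_integral (D : set T) (f : T -> V) (v : V) : Prop :=
  exists h : nat -> T -> V,
    [/\ forall n, simple_fun (h n) /\
                  (\int[mu]_(t in D) `|h n t|%:E < +oo)%E,
        {ae mu, forall t, D t -> h n t @[n --> \oo] --> f t},
        (\int[mu]_(t in D) `|f t - h n t|%:E)%E @[n --> \oo] --> 0%E &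
        simple_integral D (h n) @[n --> \oo] --> v].

(* The value is 0 when [f] is not Bochner integrable over [D]. *)
Definition bochner_integral (D : set T) (f : T -> V) : V :=
  xget 0 (has_bochner_integral D f).

Definition L2norm (D : set T) (f : T -> V) : \bar R :=
  ((\int[mu]_(t in D) (`|f t| ^+ 2)%:E) `^ 2^-1)%E.

Definition L2 (D : set T) (f : T -> V) : Prop :=
  strongly_measurable D f /\ (L2norm D f < +oo)%E.

End vector_valued.

Section operator_valued.
Context {V W : normedModType R}.

(* Elements of the Bochner space L^oo(T; L(V, W)): strong measurability is with
   respect to the operator norm. *)
Definition Linfty_op (F : T -> V -> W) : Prop :=
  [/\ forall t, bounded_op (F t),
      exists h : nat -> T -> V -> W,
        (forall n, simple_fun (h n) /\ forall t, bounded_op (h n t)) /\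
        {ae mu, forall t,
          opnorm (fun v => h n t v - F t v) @[n --> \oo] --> (0 : R)} &
      exists c : R, {ae mu, forall t, opnorm (F t) <= c}].

End operator_valued.
End bochner.

Section time_functions.
Context {R : realType}.
Local Notation mu := (@lebesgue_measure R).

(* L^2_loc(0, oo; V) in the sense of L^2(0, a; V) for every a > 0. *)
Definition L2loc {V : normedModType R} (f : R -> V) : Prop :=
  forall a : R, 0 < a -> L2 mu `[0, a] f.

(* Elements of L^p spaces are represented by functions, so periodicity of such
   an element is periodicity almost everywhere. *)
Definition ae_periodic {E : Type} (tau : R) (D : set R) (f : R -> E) : Prop :=
  {ae mu, forall t, D t -> f (t + tau) = f t}.

Definition periodic_extension {E : Type} (tau : R) (f : R -> E) (t : R) : E :=
  f (t - (Num.floor (t / tau))%:~R * tau).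

End time_functions.

Section evolution_families.
Context {R : realType} {X : normedModType R}.

(* [UA t s] is only meaningful for [s <= t]. *)
Definition evolution_family (UA : R -> R -> X -> X) : Prop :=
  [/\ forall t s, s <= t -> bounded_op (UA t s),
      forall t, UA t t = id,
      forall t r s, s <= r -> r <= t -> UA t r \o UA r s = UA t s &
      forall x, {within [set p : R * R | p.2 <= p.1],
                 continuous (fun p : R * R => UA p.1 p.2 x)}].

Definition periodic_family (tau : R) (UA : R -> R -> X -> X) : Prop :=
  forall t s, s <= t -> UA (t + tau) (s + tau) = UA t s.

Definition exponentially_stable (UA : R -> R -> X -> X) : Prop :=
  exists M omega : R, [/\ 0 < M, 0 < omega &
    forall t s, s <= t -> opnorm (UA t s) <= M * expR (- omega * (t - s))].

(* [pinv] is the inverse function of [I - UA tau 0] when this is bijective, as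
   it is under exponential stability. *)
Definition Green (tau : R) (UA : R -> R -> X -> X) (t s : R) : X -> X :=
  UA t 0 \o pinv [set: X] (fun x => x - UA tau 0 x) \o UA tau s.

End evolution_families.

Section systems.
Context {R : realType} {X U0 Ud0 Y0 : completeNormedModType R}.
Local Notation mu := (@lebesgue_measure R).
Variables (UA : R -> R -> X -> X).

Definition mild_state (B : R -> U0 -> X) (Bd : R -> Ud0 -> X)
    (x0 : X) (u : R -> U0) (w : R -> Ud0) (t : R) : X :=
  UA t 0 x0 +
  bochner_integral mu `[0, t] (fun s => UA t s (B s (u s) + Bd s (w s))).

Definition output (B : R -> U0 -> X) (Bd : R -> Ud0 -> X)
    (C : R -> X -> Y0) (D : R -> U0 -> Y0)
    (x0 : X) (u : R -> U0) (w : R -> Ud0) (t : R) : Y0 :=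
  C t (mild_state B Bd x0 u w t) + D t (u t).

Definition opP (tau : R) (B : R -> U0 -> X) (C : R -> X -> Y0)
    (D : R -> U0 -> Y0) (u : R -> U0) (t : R) : Y0 :=
  C t (bochner_integral mu `[0, tau] (fun s => Green tau UA t s (B s (u s)))) +
  C t (bochner_integral mu `[0, t] (fun s => UA t s (B s (u s)))) +
  D t (u t).

Definition opPd (tau : R) (Bd : R -> Ud0 -> X) (C : R -> X -> Y0)
    (w : R -> Ud0) (t : R) : Y0 :=
  C t (bochner_integral mu `[0, tau] (fun s => Green tau UA t s (Bd s (w s)))) +
  C t (bochner_integral mu `[0, t] (fun s => UA t s (Bd s (w s)))).

Definition regulator_equation (tau : R) (B : R -> U0 -> X) (Bd : R -> Ud0 -> X)
    (C : R -> X -> Y0) (D : R -> U0 -> Y0)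
    (yref : R -> Y0) (w : R -> Ud0) (u : R -> U0) : Prop :=
  {ae mu, forall t, t \in `[0, tau] ->
    opP tau B C D u t = yref t - opPd tau Bd C w t}.

Definition solves_output_regulation (tau : R) (B : R -> U0 -> X)
    (Bd : R -> Ud0 -> X) (C : R -> X -> Y0) (D : R -> U0 -> Y0)
    (yref : R -> Y0) (w : R -> Ud0) (u : R -> U0) : Prop :=
  exists M alpha : R, [/\ 0 < M, 0 < alpha &
    forall (x0 : X) (n : nat),
      (\int[mu]_(t in `[(n%:R * tau)%R, (n.+1%:R * tau)%R])
         (`|output B Bd C D x0 u w t - yref t| ^+ 2)%:E <=
       (M ^+ 2 * expR (- 2 * alpha * n%:R) * (`|x0| ^+ 2 + 1))%:E)%E].

End systems.

(* Main.v *)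
Require Import Defs.
From HB Require Import structures.
From mathcomp Require Import all_boot all_order all_algebra.
From mathcomp Require Import all_classical all_reals all_analysis.
From mathcomp Require Import measurable_realfun ring lra.

(** Write f = B u + B_d w for the tau-periodic forcing of the state equation,
    Phi = U_A(tau, 0) and xi = (I - Phi)^-1 int_0^tau U_A(tau, s) f(s) ds.

    The mild solution z that starts at xi satisfies
    z(tau) = Phi xi + int_0^tau U_A(tau, s) f(s) ds = xi.  Since U_A and f are
    tau-periodic, z is tau-periodic ([mild_periodic]).  The operators P and P_d
    are built from this solution: the Green function collects the term
    U_A(t, 0) xi, so that P u + P_d w = C z + D u on [0, tau]
    ([steady_outputE]).  Two mild solutions with the same forcing differ by the
    orbit of their initial difference, hence, for every x0,

      y(n tau + t) = C(t) U_A(n tau + t, 0) (x0 - xi) + (P u + P_d w)(t)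

    for almost every t in [0, tau] ([output_decomposition]), and exponential
    stability bounds the first term by a constant times
    exp (- omega tau n) |x0 - xi| ([output_transient]).

    Both halves of the theorem are read off from this formula.  If the regulator
    equation P u + P_d w = yref holds, then y - yref is the first term alone
    ([regulator_equation_sufficient]).  If the error tends to 0 in L^2, then
    P u + P_d w - yref, which does not depend on n, is a limit of errors and
    vanishes almost everywhere ([regulator_equation_necessary]).

    Most of the text develops the Bochner integral, which is given only by its
    definition through approximating simple functions: existence for strongly
    measurable functions of finite L^1 norm ([bochner_integralP]), independence
    of the approximation ([bochner_integral_cvg]), additivity, commutation with
    bounded operators, splitting of intervals and change of variables.

    Two points need care.  The Lebesgue integral of a nonnegative function that
    is not Borel measurable is a lower integral; it is monotone and blind to
    null sets ([ae_le_integral]) but not additive.  Norms of strongly measurable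
    functions are therefore replaced by Borel functions before anything is added
    ([strongly_measurable_norm]).  In the second half of the theorem,
    P u + P_d w - yref must be strongly measurable, since a nonmeasurable
    function may have lower integral 0 without vanishing almost everywhere.  For
    this it is enough that z is continuous from the right
    ([mild_right_continuous]). *)

Set Implicit Arguments.
Unset Strict Implicit.
Unset Printing Implicit Defensive.
Import Order.TTheory GRing.Theory Num.Theory.
Import numFieldNormedType.Exports.
Local Open Scope classical_set_scope.
Local Open Scope ring_scope.

(** * Simple functions *)

Section simple_functions.
Context {d : measure_display} {T : measurableType d}.

Lemma simple_fun_preimage (V : Type) (h : T -> V) (A : set V) :
  simple_fun h -> measurable (h @^-1` A).
Proof.
move=> [finh mh].
have -> : h @^-1` A = \bigcup_(v in range h `&` A) h @^-1` [set v].
  apply/seteqP; split=> [t At|t [v [_ Av] /= ->]//].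
  by exists (h t) => //; split=> //; exists t.
by apply: fin_bigcup_measurable => //; exact: finite_setIl.
Qed.

Lemma simple_fun_comp (V W : Type) (phi : V -> W) (h : T -> V) :
  simple_fun h -> simple_fun (phi \o h).
Proof.
move=> sh; split; first by rewrite -(image_comp h phi); exact: finite_image (proj1 sh).
by move=> w; rewrite comp_preimage; exact: simple_fun_preimage.
Qed.

Lemma simple_fun_cst (V : Type) (v : V) : simple_fun (fun _ : T => v).
Proof.
split; last by move=> w; rewrite preimage_cst; case: ifP.
by apply: (@sub_finite_set _ _ [set v]) => //; move=> _ [t _ <-].
Qed.

Lemma simple_fun_pair (V W : Type) (h : T -> V) (k : T -> W) :
  simple_fun h -> simple_fun k -> simple_fun (fun t => (h t, k t)).
Proof.
move=> [fh mh] [fk mk]; split.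
  apply: (sub_finite_set _ (finite_setX fh fk)) => _ [t _ <-].
  by split; exists t.
move=> [v w].
have -> : (fun t => (h t, k t)) @^-1` [set (v, w)] =
    h @^-1` [set v] `&` k @^-1` [set w].
  by apply/seteqP; split=> t /= => [[<- <-]|[-> ->]].
exact: measurableI.
Qed.

Lemma simple_fun_in (A : set T) : measurable A -> simple_fun (fun t => t \in A).
Proof.
move=> mA; split; first exact: finite_finset.
move=> [|].
  rewrite (_ : _ @^-1` _ = A)//; apply/seteqP; split=> t /=; first exact: set_mem.
  exact: mem_set.
rewrite (_ : _ @^-1` _ = ~` A); first exact: measurableC.
apply/seteqP; split=> t /=; last exact: memNset.
by move=> At /mem_set; rewrite At.
Qed.

Lemma simple_fun_if (V : Type) (A : set T) (h k : T -> V) :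
  measurable A -> simple_fun h -> simple_fun k ->
  simple_fun (fun t => if t \in A then h t else k t).
Proof.
move=> mA sh sk.
apply: (simple_fun_comp (fun p : bool * (V * V) => if p.1 then p.2.1 else p.2.2)
  (simple_fun_pair (simple_fun_in mA) (simple_fun_pair sh sk))).
Qed.

Lemma simple_fun_precomp {d'} {T' : measurableType d'} (V : Type) (phi : T' -> T)
    (h : T -> V) :
  measurable_fun setT phi -> simple_fun h -> simple_fun (h \o phi).
Proof.
move=> mphi sh; split.
  apply: (sub_finite_set _ (proj1 sh)) => _ [t _ <-]; by exists (phi t).
move=> v; rewrite comp_preimage -[X in measurable X]setTI.
by apply: mphi => //; case: sh.
Qed.

Lemma simple_fun_measurable (R : realType) (V : Type) (phi : V -> R) (h : T -> V)
    (D : set T) :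
  simple_fun h -> measurable_fun D (fun t => phi (h t)).
Proof.
move=> sh mD Y _; apply: measurableI => //.
exact: (simple_fun_preimage _ (simple_fun_comp phi sh)).
Qed.

End simple_functions.

(** * Lebesgue integrals of nonnegative functions modulo null sets *)

Section ae_integral.
Context {d : measure_display} {T : measurableType d} {R : realType}.
Variable mu : {measure set T -> \bar R}.
Import HBNNSimple.

(** The integral is the supremum over the simple functions below the integrand,
    and cutting such a function off on a null set does not change its integral;
    so arbitrary integrands can be compared. *)
Lemma ae_le_integral (D : set T) (f g : T -> \bar R) :
  (forall t, D t -> 0 <= f t)%E -> (forall t, D t -> 0 <= g t)%E ->
  {ae mu, forall t, D t -> (f t <= g t)%E} ->
  (\int[mu]_(t in D) f t <= \int[mu]_(t in D) g t)%E.
Proof.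
move=> f0 g0 [N [mN N0 fgN]]; rewrite !ge0_integralE//.
apply: ge_ereal_sup => _ [h /= hf <-].
(* [h] is cut off on the null set [N], where [f <= g] may fail. *)
pose h' := mul_nnsfun h (indic_nnsfun R (measurableC mN)).
have h'E t : h' t = h t * (t \notin N)%:R.
  by rewrite /h' /= mindicE in_setC.
have -> : sintegral mu h = sintegral mu h'.
  rewrite -!integralT_nnsfun; apply: ge0_ae_eq_integral => //.
  - by apply/measurable_EFinP; exact: measurable_funP.
  - by apply/measurable_EFinP; exact: (measurable_funP h').
  - by move=> t _; rewrite lee_fin.
  - by move=> t _; rewrite lee_fin.
  - exists N; split => // t H; apply: contrapT => Nt; apply: H => _.
    by rewrite h'E (_ : t \notin N) ?mulr1// notin_setE.
apply: ereal_sup_ubound; exists h' => // t; rewrite h'E.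
have [Nt|Nt] /= := boolP (t \in N).
  by rewrite mulr0 patchE; case: ifPn => // /set_mem/g0.
rewrite mulr1; apply: le_trans (hf t) _; rewrite !patchE.
case: ifPn => // /set_mem Dt; apply: contrapT => H; move/negP: Nt; apply.
by apply: mem_set; apply: fgN => /= /(_ Dt).
Qed.

Lemma ae_eq_integral_ge0 (D : set T) (f g : T -> \bar R) :
  (forall t, D t -> 0 <= f t)%E -> (forall t, D t -> 0 <= g t)%E ->
  {ae mu, forall t, D t -> f t = g t} ->
  (\int[mu]_(t in D) f t = \int[mu]_(t in D) g t)%E.
Proof.
move=> f0 g0 fg; apply/eqP; rewrite eq_le !ae_le_integral//.
- by apply: filterS fg => t H /H ->.
- by apply: filterS fg => t H /H ->.
Qed.

End ae_integral.

(** * Strong measurability and the L^1 norm *)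

Section strong_measurability.
Context {d : measure_display} {T : measurableType d} {R : realType}.
Variable mu : {measure set T -> \bar R}.

(** The limit of simple functions exists only almost everywhere, so the norm of
    a strongly measurable function need not be Borel measurable.  The upper
    limit of the norms of the approximants is Borel and agrees with it almost
    everywhere. *)
Lemma strongly_measurable_norm (V : normedModType R) (D : set T) (f : T -> V) :
  strongly_measurable mu D f ->
  exists g : T -> R, [/\ measurable_fun setT g, forall t, 0 <= g t &
    {ae mu, forall t, D t -> `|f t| = g t}].
Proof.
move=> [h [sh hf]].
pose g t := `|fine (limn_esup (fun n => (`|h n t|)%:E))|.
exists g; split => //.
  apply: measurableT_comp => //; apply: measurableT_comp => //.
  apply: (@measurable_fun_limn_esup _ _ _ _ (fun n t => (`|h n t|)%:E)) => n.
  apply/measurable_EFinP.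
  exact: (simple_fun_measurable (fun v : V => `|v|)).
  by move=> t; exact: normr_ge0.
apply: filterS hf => t ht Dt; rewrite /g.
have : (`|h n t|)%:E @[n --> \oo] --> (`|f t|)%:E.
  by apply: cvg_EFin; [exact: nearW|exact: cvg_norm (ht Dt)].
by move=> /cvg_limn_einf_sup[_ ->] /=; rewrite normr_id.
Qed.

Section closure.
Variable D : set T.

Lemma strongly_measurable_ae_eq (V : normedModType R) (f g : T -> V) :
  {ae mu, forall t, D t -> f t = g t} ->
  strongly_measurable mu D f -> strongly_measurable mu D g.
Proof.
move=> fg [h [sh hf]]; exists h; split => //.
by apply: filterS2 fg hf => t fg hf Dt; rewrite -fg//; exact: hf.
Qed.

Lemma strongly_measurableS (E : set T) (V : normedModType R) (f : T -> V) :
  E `<=` D -> strongly_measurable mu D f -> strongly_measurable mu E f.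
Proof.
move=> ED [h [sh hf]]; exists h; split => //.
by apply: filterS hf => t hf /ED; exact: hf.
Qed.

Lemma strongly_measurable_simple (V : normedModType R) (f : T -> V) :
  simple_fun f -> strongly_measurable mu D f.
Proof.
move=> sf; exists (fun=> f); split=> //; apply: aeW => t _; exact: cvg_cst.
Qed.

Lemma strongly_measurableD (V : normedModType R) (f g : T -> V) :
  strongly_measurable mu D f -> strongly_measurable mu D g ->
  strongly_measurable mu D (fun t => f t + g t).
Proof.
move=> [h [sh hf]] [k [sk kg]]; exists (fun n t => h n t + k n t); split.
  by move=> n; apply: (simple_fun_comp (fun p => p.1 + p.2)
    (simple_fun_pair (sh n) (sk n))).
by apply: filterS2 hf kg => t hf kg Dt; apply: cvgD; [exact: hf|exact: kg].
Qed.

Lemma strongly_measurable_comp (V W : normedModType R) (phi : V -> W) (f : T -> V) :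
  continuous phi -> strongly_measurable mu D f ->
  strongly_measurable mu D (fun t => phi (f t)).
Proof.
move=> cphi [h [sh hf]]; exists (fun n t => phi (h n t)); split.
  by move=> n; exact: (simple_fun_comp phi (sh n)).
apply: filterS hf => t hf Dt.
exact: (cvg_comp _ _ (hf Dt) (cphi (f t))).
Qed.

Lemma strongly_measurableB (V : normedModType R) (f g : T -> V) :
  strongly_measurable mu D f -> strongly_measurable mu D g ->
  strongly_measurable mu D (fun t => f t - g t).
Proof.
move=> mf mg; apply: strongly_measurableD => //.
by apply: strongly_measurable_comp mg; exact: opp_continuous.
Qed.

End closure.

Lemma strongly_measurableU (V : normedModType R) (D E : set T) (f : T -> V) :
  measurable D -> strongly_measurable mu D f -> strongly_measurable mu E f ->
  strongly_measurable mu (D `|` E) f.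
Proof.
move=> mD [h [sh hf]] [k [sk kf]].
exists (fun n t => if t \in D then h n t else k n t); split.
  by move=> n; exact: simple_fun_if.
apply: filterS2 hf kf => t hf kf DEt.
have [/set_mem|/negP Dt] := boolP (t \in D); first exact: hf.
by apply: kf; case: DEt => // /mem_set.
Qed.

End strong_measurability.

Section L1norm.
Context {d : measure_display} {T : measurableType d} {R : realType}.
Variable mu : {measure set T -> \bar R}.

Definition L1norm {V : normedModType R} (D : set T) (f : T -> V) : \bar R :=
  (\int[mu]_(t in D) `|f t|%:E)%E.

Definition bochner_integrable {V : normedModType R} (D : set T) (f : T -> V) :=
  strongly_measurable mu D f /\ (L1norm D f < +oo)%E.

Section theory.
Variables (V : normedModType R) (D : set T).
Hypothesis mD : measurable D.
Implicit Types f g : T -> V.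

Lemma L1norm_ge0 f : (0 <= L1norm D f)%E.
Proof. by apply: integral_ge0 => t _; rewrite lee_fin. Qed.

Lemma eq_L1norm (W : normedModType R) f (g : T -> W) :
  {ae mu, forall t, D t -> `|f t| = `|g t|} -> L1norm D f = L1norm D g.
Proof.
move=> fg; apply: ae_eq_integral_ge0 => [t _|t _|]; rewrite ?lee_fin//.
by apply: filterS fg => t fg Dt; rewrite fg.
Qed.

Lemma L1norm_measurable (W : normedModType R) (f : T -> W) (g : T -> R) :
  (forall t, 0 <= g t) -> {ae mu, forall t, D t -> `|f t| = g t} ->
  L1norm D f = (\int[mu]_(t in D) (g t)%:E)%E.
Proof.
move=> g0 fg; apply: ae_eq_integral_ge0 => [t _|t _|]; rewrite ?lee_fin//.
by apply: filterS fg => t fg Dt; rewrite fg.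
Qed.

(** Subadditivity of the L^1 norm, in the form in which all estimates below use
    it.  As lower integrals are only superadditive, it rests on the Borel
    versions of the norms of [f] and [g]. *)
Lemma L1norm_dominated (W W' : normedModType R) f (g : T -> W) (k : T -> W')
    (c : R) : 0 <= c ->
  strongly_measurable mu D f -> strongly_measurable mu D g ->
  {ae mu, forall t, D t -> `|k t| <= `|f t| + c * `|g t|} ->
  (L1norm D k <= L1norm D f + c%:E * L1norm D g)%E.
Proof.
move=> c0 /strongly_measurable_norm[F [mF F0 fF]].
move=> /strongly_measurable_norm[G [mG G0 gG]] kfg.
rewrite (L1norm_measurable F0 fF) (L1norm_measurable G0 gG).
have mF' : measurable_fun D F by exact: measurable_funTS.
have mG' : measurable_fun D G by exact: measurable_funTS.
rewrite -ge0_integralZl//; last 2 first.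
- by apply/measurable_EFinP.
- by move=> t _; rewrite lee_fin.
rewrite -ge0_integralD//; last 4 first.
- by move=> t _; rewrite lee_fin.
- by apply/measurable_EFinP.
- by move=> t _; rewrite mule_ge0 ?lee_fin.
- by apply/measurable_EFinP; exact: measurable_funM.
apply: ae_le_integral => [t _|t _|]; rewrite ?lee_fin//.
  by rewrite addr_ge0// mulr_ge0.
apply: filterS3 fF gG kfg => t fF gG kfg Dt.
by rewrite -EFinM -EFinD lee_fin -fF// -gG// kfg.
Qed.

End theory.
End L1norm.

(** * Integrals of simple functions *)

Section simple_integral.
Context {d : measure_display} {T : measurableType d} {R : realType}.
Variable mu : {measure set T -> \bar R}.
Variable D : set T.
Hypotheses (mD : measurable D) (finD : (mu D < +oo)%E).

Let m (A : set T) : R := fine (mu (D `&` A)).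

Let measurable_fiber (P : Type) (p : T -> P) (q : P) :
  simple_fun p -> measurable (D `&` p @^-1` [set q]).
Proof. by move=> [_ mp]; exact: measurableI. Qed.

Let trivIset_fiber (P : Type) (p : T -> P) (A : set P) :
  trivIset A (fun q => D `&` p @^-1` [set q]).
Proof. by move=> q r _ _ [t [[_ <-] [_ <-]]]. Qed.

Let m_fibers (P : choiceType) (p : T -> P) (Q : pred P) (s : seq P) :
  simple_fun p -> uniq s -> range p `<=` [set` s] ->
  m (p @^-1` [set q | Q q]) = \sum_(q <- s | Q q) m (p @^-1` [set q]).
Proof.
move=> sp us ps; rewrite /m sum_fine; last first.
  move=> q _; rewrite ge0_fin_numE//; apply: le_lt_trans finD.
  by apply: le_measure; rewrite ?inE//; exact: measurable_fiber.
rewrite -big_filter; set r := [seq q <- s | Q q].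
rewrite fsbig_seq ?filter_uniq// -measure_fin_bigcup//; last first.
  by move=> q _; exact: measurable_fiber.
congr (fine (mu _)); apply/seteqP; split=> [t [Dt /= Qt]|t [q]].
  by exists (p t) => //=; rewrite mem_filter Qt; apply: ps; exists t.
by rewrite /= mem_filter => /andP[Qq _] [Dt /= ptq]; split => //=; rewrite ptq.
Qed.

(** Identities between simple integrals are proved by choosing a common [p]: the
    sum can be taken over the fibers of [p], even where [phi] identifies some of
    them. *)
Lemma simple_integral_comp (V : normedModType R) (P : choiceType) (p : T -> P)
    (phi : P -> V) (s : seq P) :
  simple_fun p -> uniq s -> range p `<=` [set` s] ->
  simple_integral mu D (phi \o p) =
  \sum_(q <- s) fine (mu (D `&` p @^-1` [set q])) *: phi q.
Proof.
move=> sp us ps; rewrite /simple_integral.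
rewrite (fsbigE (undup (map phi s))) ?undup_uniq//; last first.
  move=> v _; rewrite mem_undup => vs.
  rewrite (_ : _ @^-1` _ = set0) ?setI0 ?measure0 ?scale0r//.
  apply/seteqP; split => // t /= ptv; move/negP: vs; apply.
  by rewrite -ptv map_f//; apply: ps; exists t.
have mE v : fine (mu (D `&` (phi \o p) @^-1` [set v])) =
    \sum_(q <- s | phi q == v) fine (mu (D `&` p @^-1` [set q])).
  rewrite -(m_fibers (fun q => phi q == v) sp us ps).
  by congr (fine (mu (D `&` _))); apply/seteqP; split=> t /= /eqP.
under eq_bigl do rewrite in_setT.
transitivity (\sum_(v <- undup (map phi s)) \sum_(q <- s | phi q == v)
    fine (mu (D `&` p @^-1` [set q])) *: phi q).
  apply: eq_bigr => v _; rewrite mE scaler_suml.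
  by apply: eq_bigr => q /eqP <-.
rewrite (exchange_big_dep xpredT)//=.
rewrite big_seq [RHS]big_seq; apply: eq_bigr => q qs.
rewrite big_const_seq (@eq_count _ _ (pred1 (phi q))); last first.
  by move=> v /=; rewrite eq_sym.
by rewrite count_uniq_mem ?undup_uniq// mem_undup map_f//= addr0.
Qed.

Let simple_range (P : choiceType) (p : T -> P) : simple_fun p ->
  exists s : seq P, uniq s /\ range p `<=` [set` s].
Proof.
move=> [/finite_seqP[s ps] _]; exists (undup s); rewrite undup_uniq ps.
by split => // q /=; rewrite mem_undup.
Qed.

Section additivity.
Variable V : normedModType R.
Implicit Types h k : T -> V.

(** Both integrals are computed on the fibers of the pair of [h] and [k]. *)
Lemma simple_integralB h k : simple_fun h -> simple_fun k ->
  simple_integral mu D (fun t => h t - k t) =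
  simple_integral mu D h - simple_integral mu D k.
Proof.
move=> sh sk; have spair := simple_fun_pair sh sk.
have [s [us ps]] := simple_range spair.
rewrite (simple_integral_comp (fun q : V * V => q.1 - q.2) spair us ps).
rewrite (simple_integral_comp (fun q : V * V => q.1) spair us ps).
rewrite (simple_integral_comp (fun q : V * V => q.2) spair us ps).
by rewrite -sumrB; apply: eq_bigr => q _; rewrite scalerBr.
Qed.

Lemma simple_integralD h k : simple_fun h -> simple_fun k ->
  simple_integral mu D (fun t => h t + k t) =
  simple_integral mu D h + simple_integral mu D k.
Proof.
move=> sh sk; have spair := simple_fun_pair sh sk.
have [s [us ps]] := simple_range spair.
rewrite (simple_integral_comp (fun q : V * V => q.1 + q.2) spair us ps).
rewrite (simple_integral_comp (fun q : V * V => q.1) spair us ps).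
rewrite (simple_integral_comp (fun q : V * V => q.2) spair us ps).
by rewrite -big_split; apply: eq_bigr => q _; rewrite scalerDr.
Qed.

Lemma simple_integral_linear (W : normedModType R) (L : {linear V -> W}) h :
  simple_fun h ->
  simple_integral mu D (fun t => L (h t)) = L (simple_integral mu D h).
Proof.
move=> sh; have [s [us ps]] := simple_range sh.
rewrite (simple_integral_comp L sh us ps).
rewrite (simple_integral_comp idfun sh us ps) linear_sum.
by apply: eq_bigr => v _; rewrite linearZ.
Qed.

Lemma L1norm_simple h (s : seq V) : simple_fun h -> uniq s ->
  range h `<=` [set` s] ->
  L1norm mu D h = (\sum_(v <- s) fine (mu (D `&` h @^-1` [set v])) * `|v|)%:E.
Proof.
move=> sh us hs; rewrite /L1norm.
have DE : D = \big[setU/set0]_(v <- s) (D `&` h @^-1` [set v]).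
  rewrite -bigcup_seq; apply/seteqP; split=> [t Dt|t [v _ [Dt _]]//].
  by exists (h t) => //; apply: hs; exists t.
rewrite {1}DE ge0_integral_bigsetU//; last 2 first.
- by move=> v; exact: measurable_fiber.
- by apply/measurable_EFinP; exact: (simple_fun_measurable (fun v : V => `|v|)).
rewrite -sumEFin; apply: eq_bigr => v _.
rewrite (eq_integral (cst `|v|%:E)); last by move=> t /set_mem[_ /= ->].
rewrite integral_cst; last exact: measurable_fiber.
rewrite EFinM fineK 1?muleC// ge0_fin_numE//; apply: le_lt_trans finD.
by apply: le_measure; rewrite ?inE//; exact: measurable_fiber.
Qed.

Lemma L1norm_simple_lty h : simple_fun h -> (L1norm mu D h < +oo)%E.
Proof.
move=> sh; have [s [us ps]] := simple_range sh.
by rewrite (L1norm_simple sh us ps) ltry.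
Qed.

Lemma norm_simple_integral h : simple_fun h ->
  (`|simple_integral mu D h|%:E <= L1norm mu D h)%E.
Proof.
move=> sh; have [s [us ps]] := simple_range sh.
rewrite (L1norm_simple sh us ps) (simple_integral_comp idfun sh us ps) lee_fin.
apply: le_trans (ler_norm_sum _ _ _) _; apply: ler_sum => v _.
by rewrite normrZ ger0_norm// fine_ge0.
Qed.

End additivity.
End simple_integral.

(** * The Bochner integral *)

Section squeeze.
Context {R : realType}.

Lemma norm_cvge0 (V : normedModType R) (u : nat -> V) (a : nat -> \bar R) :
  (forall n, `|u n|%:E <= a n)%E -> a n @[n --> \oo] --> 0%E ->
  u n @[n --> \oo] --> 0.
Proof.
move=> ua a0; apply: norm_cvg0.
have : `|u n|%:E @[n --> \oo] --> 0%E.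
  apply: (@squeeze_cvge _ _ _ _ (cst 0%E) _ a) => //; last exact: cvg_cst.
  by apply: nearW => n; rewrite lee_fin normr_ge0 ua.
by move=> /fine_cvg.
Qed.

Lemma cvg_of_cauchy_bound (V : completeNormedModType R) (u : nat -> V)
    (a : nat -> R) :
  (forall n m, `|u n - u m| <= a n + a m) -> a n @[n --> \oo] --> 0 ->
  exists l : V, u n @[n --> \oo] --> l.
Proof.
move=> ua a0; exists (lim (u @ \oo)); apply: cauchy_cvg; apply: cauchy_exP => e e0.
have aE : \forall n \near \oo, `|a n| < e / 2.
  by apply: cvgr0_norm_lt => //; rewrite divr_gt0.
have [N _ aN] := aE; exists (u N), N => // m /= Nm.
rewrite -ball_normE /=; apply: le_lt_trans (ua _ _) _.
by rewrite [ltRHS]splitr ltrD//; apply: le_lt_trans (ler_norm _) _; apply: aN;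
  rewrite /= ?leqnn.
Qed.

End squeeze.

Section bochner.
Context {d : measure_display} {T : measurableType d} {R : realType}.
Variable mu : {measure set T -> \bar R}.

(** The two functions have the same approximating sequences, so the two choices
    made by the definition of the integral are choices from the same set. *)
Lemma bochner_integral_ae_eq (V : normedModType R) (D : set T) (f g : T -> V) :
  {ae mu, forall t, D t -> f t = g t} ->
  bochner_integral mu D f = bochner_integral mu D g.
Proof.
have sub (f1 f2 : T -> V) v : {ae mu, forall t, D t -> f1 t = f2 t} ->
    has_bochner_integral mu D f1 v -> has_bochner_integral mu D f2 v.
  move=> f12 [h [sh hf fh hv]]; exists h; split => //.
    by apply: filterS2 f12 hf => t f12 hf Dt; rewrite -f12//; exact: hf.
  rewrite (_ : (fun n => _) = (fun n => L1norm mu D (fun t => f1 t - h n t)))//.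
  apply/funext => n; apply: eq_L1norm; apply: filterS f12 => t f12 Dt.
  by rewrite f12.
move=> fg; rewrite /bochner_integral; congr (xget 0 _).
apply/funext => v; apply/propext; split; apply: sub => //.
by apply: filterS fg => t fg Dt; rewrite fg.
Qed.

Section finite_measure_set.
Variable D : set T.
Hypotheses (mD : measurable D) (finD : (mu D < +oo)%E).

Section approximation.
Variable V : normedModType R.
Implicit Types f : T -> V.

(** Pointwise approximants [h n] are cut off where their norm exceeds twice that
    of [f].  The factor 2 keeps the cut-off sequence convergent wherever [f] is
    not 0, and where [f] is 0 it forces the approximants to be 0.  Dominated
    convergence with bound 3 |f| then turns pointwise convergence into
    convergence in L^1. *)
Lemma bochner_integrable_approx f : bochner_integrable mu D f ->
  exists h : nat -> T -> V, [/\ forall n, simple_fun (h n),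
    {ae mu, forall t, D t -> h n t @[n --> \oo] --> f t} &
    L1norm mu D (fun t => f t - h n t) @[n --> \oo] --> 0%E].
Proof.
move=> [mf finf]; have [h [sh hf]] := mf.
have [g [mg g0 fg]] := strongly_measurable_norm mf.
(* The cut-off uses the Borel version [g] of the norm of [f]. *)
pose A n := [set t | `|h n t| <= 2 * g t].
have mA n : measurable (A n).
  rewrite /A -[X in measurable X]setTI.
  apply: measurable_fun_ler => //; last exact: measurable_funM.
  exact: (simple_fun_measurable (fun v : V => `|v|)).
pose k n t := if t \in A n then h n t else 0.
have sk n : simple_fun (k n) by apply: simple_fun_if => //; exact: simple_fun_cst.
have kg n t : `|k n t| <= 2 * g t.
  by rewrite /k; case: ifPn => [/set_mem//|_]; rewrite normr0 mulr_ge0.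
have kf : {ae mu, forall t, D t -> k n t @[n --> \oo] --> f t}.
  apply: filterS2 hf fg => t hf fg Dt.
  have [ft0|ft0] := eqVneq (f t) 0.
    have g0' : g t = 0 by rewrite -fg// ft0 normr0.
    rewrite ft0 (_ : (fun n => k n t) = (fun=> 0)); first exact: cvg_cst.
    apply/funext => n; apply/eqP; rewrite -normr_le0.
    by apply: le_trans (kg n t) _; rewrite g0' mulr0.
  apply: cvg_trans (hf Dt); apply: near_eq_cvg.
  have : `|h n t| @[n --> \oo] --> `|f t| by exact: cvg_norm (hf Dt).
  move=> /cvgr_lt/(_ (2 * `|f t|)) hlt; near=> n.
  rewrite /k ifT// inE /A /= -fg//; apply: ltW; near: n.
  by apply: hlt; rewrite ltr_pMl ?normr_gt0// ltr1n.
exists k; split=> //.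
have mfk n : strongly_measurable mu D (fun t => f t - k n t).
  by apply: strongly_measurableB => //; exact: strongly_measurable_simple.
have /choice[G GP] : forall n, exists g : T -> R, [/\ measurable_fun setT g,
    forall t, 0 <= g t & {ae mu, forall t, D t -> `|f t - k n t| = g t}].
  by move=> n; exact: strongly_measurable_norm.
have /ae_foralln fkG : forall n, {ae mu, forall t, D t -> `|f t - k n t| = G n t}.
  by move=> n; have [] := GP n.
rewrite (_ : (fun n => _) = (fun n => \int[mu]_(t in D) (G n t)%:E))%E; last first.
  by apply/funext => n; have [mG G0 fG] := GP n; exact: L1norm_measurable.
have := @dominated_convergence _ _ _ mu D mD (fun n t => (G n t)%:E) (cst 0%E)
  (fun t => (3 * g t)%:E).
case => //.
- by move=> n; apply/measurable_EFinP; have [+ _ _] := GP n; exact: measurable_funTS.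
- apply: filterS2 kf fkG => t kf fkG Dt; apply: cvg_EFin; first exact: nearW.
  rewrite (_ : _ \o _ = fun n => `|f t - k n t|); last first.
    by apply/funext => n; rewrite /= -fkG.
  rewrite -[X in _ --> X](normr0 V); apply: cvg_norm.
  by rewrite -[X in _ --> X](subrr (f t)); apply: cvgB; [exact: cvg_cst|exact: kf].
- apply/integrableP; split.
    by apply/measurable_EFinP; apply: measurable_funTS; exact: measurable_funM.
  under eq_integral do rewrite EFinM abseM !gee0_abs ?lee_fin//.
  rewrite ge0_integralZl//.
  + by rewrite -(L1norm_measurable g0 fg) lte_mul_pinfty.
  + by apply/measurable_EFinP; exact: measurable_funTS.
  + by move=> t _; rewrite lee_fin.
- apply: filterS2 fg fkG => t fg fkG n Dt.
  rewrite gee0_abs ?lee_fin; last by have [_ + _] := GP n.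
  rewrite -fkG//; apply: le_trans (ler_normB _ _) _.
  by rewrite fg// (_ : 3 = 1 + 2)// mulrDl mul1r lerD2l.
by move=> _ _; rewrite integral0.
Unshelve. all: by end_near. Qed.

Lemma simple_integral_dist f (h k : T -> V) : strongly_measurable mu D f ->
  simple_fun h -> simple_fun k ->
  (`|simple_integral mu D h - simple_integral mu D k|%:E <=
   L1norm mu D (fun t => f t - h t)%R + L1norm mu D (fun t => f t - k t)%R)%E.
Proof.
move=> mf sh sk; rewrite -simple_integralB//.
have shk : simple_fun (fun t => h t - k t).
  by apply: (simple_fun_comp (fun p => p.1 - p.2) (simple_fun_pair sh sk)).
apply: le_trans (norm_simple_integral mD finD shk) _.
have mh := strongly_measurable_simple mu D sh.
have mk := strongly_measurable_simple mu D sk.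
rewrite -[X in (_ + X)%E]mul1e; apply: L1norm_dominated => //.
- exact: strongly_measurableB.
- exact: strongly_measurableB.
apply: aeW => t Dt; rewrite mul1r [X in _ <= X + _]distrC.
have -> : h t - k t = (h t - f t) + (f t - k t) by rewrite addrA subrK.
exact: ler_normD.
Qed.

End approximation.

Section integral.
Variable V : completeNormedModType R.
Implicit Types f g : T -> V.

(** The integrals of an approximating sequence are Cauchy, by
    [simple_integral_dist]; this is where completeness of [V] enters. *)
Lemma bochner_integralP f : bochner_integrable mu D f ->
  has_bochner_integral mu D f (bochner_integral mu D f).
Proof.
move=> intf; apply: xgetPex.
have [h [sh hf fh]] := bochner_integrable_approx intf.
have [mf _] := intf.
have finh n : L1norm mu D (fun t => f t - h n t) \is a fin_num.
  rewrite ge0_fin_numE ?L1norm_ge0//.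
  apply: (@le_lt_trans _ _ (L1norm mu D f + 1%:E * L1norm mu D (h n))%E).
    apply: L1norm_dominated => //; first exact: strongly_measurable_simple.
    by apply: aeW => t _; rewrite mul1r ler_normB.
  by rewrite mul1e lte_add_pinfty//; [case: intf|exact: L1norm_simple_lty].
have [v hv] : exists v : V, simple_integral mu D (h n) @[n --> \oo] --> v.
  apply: (cvg_of_cauchy_bound (a := fun n => fine (L1norm mu D (fun t => f t - h n t)))).
    move=> n m; rewrite -lee_fin EFinD !fineK//; exact: simple_integral_dist.
  exact: fine_cvg fh.
by exists v, h; split => // n; split => //; exact: L1norm_simple_lty.
Qed.

(** Any L^1 approximation computes the integral.  The algebraic properties of
    the integral follow by applying an operation to the approximants. *)
Lemma bochner_integral_cvg f (k : nat -> T -> V) : bochner_integrable mu D f ->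
  (forall n, simple_fun (k n)) ->
  L1norm mu D (fun t => f t - k n t) @[n --> \oo] --> 0%E ->
  simple_integral mu D (k n) @[n --> \oo] --> bochner_integral mu D f.
Proof.
move=> intf sk fk; have [h [sh hf fh hv]] := bochner_integralP intf.
rewrite -[X in _ --> X]add0r -[X in X + _]oppr0.
rewrite (_ : (fun n => _) = (fun n => - (simple_integral mu D (h n) -
  simple_integral mu D (k n)) + simple_integral mu D (h n))); last first.
  by apply/funext => n; rewrite opprB subrK.
apply: cvgD => //; apply: cvgN.
apply: (norm_cvge0 (a := fun n => L1norm mu D (fun t => f t - h n t)%R +
   L1norm mu D (fun t => f t - k n t)%R))%E.
  by move=> n; apply: simple_integral_dist => //; [case: intf|case: (sh n)].
by rewrite -[X in _ --> X]add0e; apply: cvgeD.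
Qed.

Lemma norm_bochner_integral f : bochner_integrable mu D f ->
  (`|bochner_integral mu D f|%:E <= L1norm mu D f)%E.
Proof.
move=> intf; have [h [sh _ fh]] := bochner_integrable_approx intf.
have mf : strongly_measurable mu D f by case: intf.
have Ih := bochner_integral_cvg intf sh fh.
have nIh : `|simple_integral mu D (h n)|%:E @[n --> \oo] -->
    `|bochner_integral mu D f|%:E.
  by apply: cvg_EFin; [exact: nearW|exact: cvg_norm Ih].
have bnd : (L1norm mu D f + 1%:E * L1norm mu D (fun t => f t - h n t)%R)%E
    @[n --> \oo] --> (L1norm mu D f + 0)%E.
  apply: cvgeD; first by rewrite fin_num_adde_defl.
  - exact: cvg_cst.
  - by under eq_fun do rewrite mul1e.
rewrite -[leRHS]adde0; apply: (lee_cvg_to nIh bnd); apply: nearW => n.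
apply: le_trans (norm_simple_integral mD finD (sh n)) _.
have mh := strongly_measurable_simple mu D (sh n).
apply: L1norm_dominated => //; first exact: strongly_measurableB.
apply: aeW => t _; rewrite mul1r.
by rewrite -[h n t in X in X <= _](subKr (f t)) ler_normB.
Qed.

End integral.
End finite_measure_set.
End bochner.

(** * Bounded operators and operator-valued functions *)

Section bounded_operators.
Context {R : realType} {V W : normedModType R}.
Implicit Types F G : V -> W.

Lemma norm_cvgr0 (u : nat -> V) (a : nat -> R) :
  (forall n, `|u n| <= a n) -> a n @[n --> \oo] --> 0 -> u n @[n --> \oo] --> 0.
Proof.
move=> ua a0; apply: (norm_cvge0 (a := fun n => (a n)%:E)) => [n|].
  by rewrite lee_fin.
by apply: cvg_EFin => //; exact: nearW.
Qed.

Lemma bounded_op_linear F : bounded_op F -> exists L : {linear V -> W}, F = L.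
Proof.
move=> [linF _].
pose L : {linear V -> W} := HB.pack F (GRing.isLinear.Build R V W *:%R F linF).
by exists L.
Qed.

Lemma linear_bounded_op F (c : R) : linear F -> (forall v, `|F v| <= c * `|v|) ->
  bounded_op F.
Proof.
move=> linF Fc; split=> //.
pose L : {linear V -> W} := HB.pack F (GRing.isLinear.Build R V W *:%R F linF).
apply: (@bounded_linear_continuous _ _ _ L); apply/linear_boundedP.
exists c; split; first exact: num_real.
by move=> r /ltW cr v; apply: le_trans (Fc v) _; exact: ler_wpM2r.
Qed.

Lemma bounded_opB F G : bounded_op F -> bounded_op G ->
  bounded_op (fun v => F v - G v).
Proof.
move=> [linF cF] [linG cG]; split.
  move=> a u v; rewrite linF linG.
  by rewrite scalerBr opprD !addrA; congr (_ + _); rewrite addrAC.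
by move=> v; apply: cvgB; [exact: cF|exact: cG].
Qed.

Lemma bounded_op_comp (U : normedModType R) F (G : U -> V) :
  bounded_op F -> bounded_op G -> bounded_op (F \o G).
Proof.
move=> [linF cF] [linG cG]; split; first by move=> a u v /=; rewrite linG linF.
by move=> u; apply: continuous_comp; [exact: cG|exact: cF].
Qed.

Let has_sup_opnorm F : bounded_op F ->
  has_sup [set `|F v| | v in [set v : V | `|v| <= 1]].
Proof.
move=> bF; have [L LE] := bounded_op_linear bF.
split; first by exists `|F 0|, 0 => //=; rewrite normr0 ler01.
have /linear_boundedP/pinfty_ex_gt0[c c0 Lc] : bounded_near L (nbhs 0).
  by apply: continuous_linear_bounded; rewrite -LE; have [_ cF] := bF; exact: cF.
exists c => _ [v /= v1 <-]; rewrite LE; apply: le_trans (Lc v) _.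
by rewrite ler_piMr// ltW.
Qed.

Lemma opnorm_ge0 F : bounded_op F -> 0 <= opnorm F.
Proof.
move=> bF; apply: le_trans (normr_ge0 (F 0)) _; apply: sup_upper_bound.
  exact: has_sup_opnorm.
by exists 0 => //=; rewrite normr0 ler01.
Qed.

Lemma le_opnorm F v : bounded_op F -> `|F v| <= opnorm F * `|v|.
Proof.
move=> bF; have [L LE] := bounded_op_linear bF.
have [->|v0] := eqVneq v 0; first by rewrite LE linear0 !normr0 mulr0.
have nv0 : 0 < `|v| by rewrite normr_gt0.
rewrite -ler_pdivrMr//; apply: sup_upper_bound; first exact: has_sup_opnorm.
exists (`|v|^-1 *: v) => /=.
  by rewrite normrZ ger0_norm ?invr_ge0// mulVf ?gt_eqF.
by rewrite LE linearZ /= normrZ ger0_norm ?invr_ge0// mulrC.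
Qed.

End bounded_operators.

Section integrable_operations.
Context {d : measure_display} {T : measurableType d} {R : realType}.
Variable mu : {measure set T -> \bar R}.

(** Simple approximants of [F] in operator norm, evaluated at simple
    approximants of [u], are simple and converge to [F t (u t)]. *)
Lemma strongly_measurable_op (V W : normedModType R) (F : T -> V -> W)
    (D : set T) (u : T -> V) :
  Linfty_op mu F -> strongly_measurable mu D u ->
  strongly_measurable mu D (fun t => F t (u t)).
Proof.
move=> [bF [H [sbH HF]] _] [h [sh hu]].
exists (fun n t => H n t (h n t)); split.
  move=> n; have [sH _] := sbH n.
  exact: (simple_fun_comp (fun p => p.1 p.2) (simple_fun_pair sH (sh n))).
apply: filterS2 HF hu => t HF hu Dt.
have bHF n : bounded_op (fun v => H n t v - F t v).
  by apply: bounded_opB => //; have [_] := sbH n.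
rewrite -[X in _ --> X]add0r.
rewrite (_ : (fun n => _) = (fun n => (H n t (h n t) - F t (h n t)) +
  F t (h n t))); last by apply/funext => n; rewrite subrK.
apply: cvgD; last first.
  by apply: (cvg_comp _ _ (hu Dt)); have [_] := bF t; exact.
apply: (norm_cvgr0 (a := fun n => opnorm (fun v => H n t v - F t v) * `|h n t|)).
  by move=> n; apply: (@le_opnorm _ _ _ (fun v => H n t v - F t v)).
by rewrite -(mul0r `|u t|); apply: cvgM => //; exact: cvg_norm (hu Dt).
Qed.

Lemma Linfty_op_bound (V W : normedModType R) (F : T -> V -> W) :
  Linfty_op mu F ->
  exists2 c : R, 0 <= c & {ae mu, forall t v, `|F t v| <= c * `|v|}.
Proof.
move=> [bF _ [c Fc]]; exists `|c| => //.
apply: filterS Fc => t Fc v; apply: le_trans (le_opnorm v (bF t)) _.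
by rewrite ler_wpM2r// (le_trans Fc)// ler_norm.
Qed.

Section measurable_set.
Variable D : set T.
Hypothesis mD : measurable D.

Lemma bochner_integrable_dominated (V W : normedModType R) (f : T -> V)
    (g : T -> W) (c : R) : 0 <= c ->
  {ae mu, forall t, D t -> `|g t| <= c * `|f t|} ->
  bochner_integrable mu D f -> strongly_measurable mu D g ->
  bochner_integrable mu D g.
Proof.
move=> c0 gf [mf finf] mg; split=> //.
have [F [mF F0 fF]] := strongly_measurable_norm mf.
apply: (@le_lt_trans _ _ (\int[mu]_(t in D) (c%:E * (F t)%:E))%E).
  apply: ae_le_integral => [t _|t _|]; first by rewrite lee_fin.
    by rewrite mule_ge0 ?lee_fin.
  apply: filterS2 gf fF => t gf fF Dt.
  by rewrite -EFinM lee_fin -fF// gf.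
rewrite ge0_integralZl//.
- by rewrite -(L1norm_measurable F0 fF) lte_mul_pinfty.
- by apply/measurable_EFinP; exact: measurable_funTS.
- by move=> t _; rewrite lee_fin.
Qed.

Lemma bochner_integrable_op (V W : normedModType R) (F : T -> V -> W)
    (u : T -> V) :
  Linfty_op mu F -> bochner_integrable mu D u ->
  bochner_integrable mu D (fun t => F t (u t)).
Proof.
move=> hF hu; have [c c0 Fc] := Linfty_op_bound hF.
apply: (bochner_integrable_dominated c0 _ hu).
  by apply: filterS Fc => t Fc _.
by apply: strongly_measurable_op => //; case: hu.
Qed.

Lemma bochner_integrable_bounded_op (V W : normedModType R) (F : V -> W)
    (u : T -> V) :
  bounded_op F -> bochner_integrable mu D u ->
  bochner_integrable mu D (fun t => F (u t)).
Proof.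
move=> bF hu; apply: (bochner_integrable_dominated (opnorm_ge0 bF) _ hu).
  by apply: aeW => t _; exact: le_opnorm.
by apply: strongly_measurable_comp; [case: bF|case: hu].
Qed.

Lemma bochner_integrableD (V : normedModType R) (f g : T -> V) :
  bochner_integrable mu D f -> bochner_integrable mu D g ->
  bochner_integrable mu D (fun t => f t + g t).
Proof.
move=> [mf finf] [mg fing]; split; first exact: strongly_measurableD.
apply: (@le_lt_trans _ _ (L1norm mu D f + 1%:E * L1norm mu D g)%E).
  by apply: L1norm_dominated => //; apply: aeW => t _; rewrite mul1r ler_normD.
by rewrite mul1e lte_add_pinfty.
Qed.

Lemma bochner_integrable_ae_eq (V : normedModType R) (f g : T -> V) :
  {ae mu, forall t, D t -> f t = g t} ->
  bochner_integrable mu D f -> bochner_integrable mu D g.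
Proof.
move=> fg [mf finf]; split; first exact: strongly_measurable_ae_eq mf.
rewrite -(@eq_L1norm _ _ _ mu V D V f)//.
by apply: filterS fg => t fg Dt; rewrite fg.
Qed.

Lemma bochner_integrableS (E : set T) (V : normedModType R) (f : T -> V) :
  measurable E -> E `<=` D ->
  bochner_integrable mu D f -> bochner_integrable mu E f.
Proof.
move=> mE ED [mf finf]; split; first exact: strongly_measurableS mf.
have [F [mF F0 fF]] := strongly_measurable_norm mf.
apply: le_lt_trans finf; rewrite (L1norm_measurable F0 fF).
rewrite (@L1norm_measurable _ _ _ mu E V f F)//; last first.
  by apply: filterS fF => t + /ED.
apply: ge0_subset_integral => //; last by move=> t _; rewrite lee_fin.
by apply/measurable_EFinP; exact: measurable_funTS.
Qed.

End measurable_set.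

Lemma bochner_integrableU (D E : set T) (V : normedModType R) (f : T -> V) :
  measurable D -> measurable E ->
  bochner_integrable mu D f -> bochner_integrable mu E f ->
  bochner_integrable mu (D `|` E) f.
Proof.
move=> mD mE [mfD finD] [mfE finE].
have mf : strongly_measurable mu (D `|` E) f by exact: strongly_measurableU.
split=> //; have [F [mF F0 fF]] := strongly_measurable_norm mf.
have mF' A : measurable_fun A (EFin \o F).
  by apply/measurable_EFinP; exact: measurable_funTS.
(* Additivity of the integral needs disjoint sets. *)
have DE : D `|` E = D `|` (E `\` D).
  by apply/seteqP; split=> t; have [] := pselect (D t); rewrite /setU/setD/=; tauto.
have [_ finED] : bochner_integrable mu (E `\` D) f.
  by apply: (@bochner_integrableS E) => //; exact: measurableD.
rewrite (L1norm_measurable F0 fF) DE ge0_integral_setU//; last 3 first.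
- exact: measurableD.
- by move=> t _; rewrite lee_fin.
- by apply/disj_setPS => t [Dt []].
rewrite -(@L1norm_measurable _ _ _ mu D V f)//; last first.
  by apply: filterS fF => t fF Dt; apply: fF; left.
rewrite -(@L1norm_measurable _ _ _ mu (E `\` D) V f)//; last first.
  by apply: filterS fF => t fF [Et _]; apply: fF; right.
by rewrite lte_add_pinfty.
Qed.

End integrable_operations.

(** * Additivity, bounded operators and unions of domains *)

Section integral_operations.
Context {d : measure_display} {T : measurableType d} {R : realType}.
Variable mu : {measure set T -> \bar R}.

Section finite_measure_set.
Variable D : set T.
Hypotheses (mD : measurable D) (finD : (mu D < +oo)%E).

Lemma bochner_integralD (V : completeNormedModType R) (f g : T -> V) :
  bochner_integrable mu D f -> bochner_integrable mu D g ->
  bochner_integral mu D (fun t => f t + g t) =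
  bochner_integral mu D f + bochner_integral mu D g.
Proof.
move=> hf hg.
have [h [sh _ fh]] := bochner_integrable_approx mD hf.
have [k [sk _ gk]] := bochner_integrable_approx mD hg.
have shk n : simple_fun (fun t => h n t + k n t).
  by apply: (simple_fun_comp (fun p => p.1 + p.2) (simple_fun_pair (sh n) (sk n))).
have fgc : simple_integral mu D (fun t => h n t + k n t) @[n --> \oo] -->
    bochner_integral mu D (fun t => f t + g t).
  apply: bochner_integral_cvg => //; first exact: bochner_integrableD.
  apply: (@squeeze_cvge _ _ _ _ (cst 0%E) _ (fun n =>
    L1norm mu D (fun t => f t - h n t)%R +
    1%:E * L1norm mu D (fun t => g t - k n t)%R)%E).
  - apply: nearW => n; rewrite L1norm_ge0/=; apply: L1norm_dominated => //.
    + by apply: strongly_measurableB; [case: hf|exact: strongly_measurable_simple].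
    + by apply: strongly_measurableB; [case: hg|exact: strongly_measurable_simple].
    + by apply: aeW => t _; rewrite mul1r opprD addrACA ler_normD.
  - exact: cvg_cst.
  - under eq_fun do rewrite mul1e.
    by rewrite -(adde0 0%E); apply: cvgeD.
rewrite (funext (fun n => simple_integralD mD finD (sh n) (sk n))) in fgc.
apply: (cvg_unique _ fgc) => //.
by apply: cvgD; exact: bochner_integral_cvg.
Qed.

Lemma bochner_integral_op (V W : completeNormedModType R) (F : V -> W) (f : T -> V) :
  bounded_op F -> bochner_integrable mu D f ->
  bochner_integral mu D (fun t => F (f t)) = F (bochner_integral mu D f).
Proof.
move=> bF hf; have [L LE] := bounded_op_linear bF.
have [h [sh _ fh]] := bochner_integrable_approx mD hf.
have sLh n : simple_fun (fun t => F (h n t)) by exact: (simple_fun_comp F (sh n)).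
have Fc : simple_integral mu D (fun t => F (h n t)) @[n --> \oo] -->
    bochner_integral mu D (fun t => F (f t)).
  apply: bochner_integral_cvg => //; first exact: bochner_integrable_bounded_op.
  apply: (@squeeze_cvge _ _ _ _ (cst 0%E) _ (fun n =>
    L1norm mu D (fun=> 0%R : R) +
    (opnorm F)%:E * L1norm mu D (fun t => f t - h n t)%R)%E).
  - apply: nearW => n; rewrite L1norm_ge0/=; apply: L1norm_dominated => //.
    + exact: opnorm_ge0.
    + by apply: strongly_measurable_simple; exact: simple_fun_cst.
    + by apply: strongly_measurableB; [case: hf|exact: strongly_measurable_simple].
    + apply: aeW => t _; rewrite normr0 add0r; apply: le_trans (le_opnorm _ bF).
      by rewrite LE linearB.
  - exact: cvg_cst.
  - rewrite /L1norm; under eq_fun do rewrite normr0 integral0 add0e.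
    by rewrite -(mule0 (opnorm F)%:E); apply: cvgeZl.
rewrite LE (funext (fun n => simple_integral_linear mD finD L (sh n))) -LE in Fc.
apply: (cvg_unique _ Fc) => //.
apply: (cvg_comp _ _ (bochner_integral_cvg mD finD hf sh fh)).
by have [_] := bF; exact.
Qed.

End finite_measure_set.

Lemma bochner_integral_setU (V : completeNormedModType R) (D E : set T) (f : T -> V) :
  measurable D -> measurable E -> (mu D < +oo)%E -> (mu E < +oo)%E ->
  mu (D `&` E) = 0%E -> bochner_integrable mu (D `|` E) f ->
  bochner_integral mu (D `|` E) f =
  bochner_integral mu D f + bochner_integral mu E f.
Proof.
move=> mD mE finD finE DE0 hf.
have mDE : measurable (D `|` E) by exact: measurableU.
have finDE : (mu (D `|` E) < +oo)%E.
  by apply: le_lt_trans (measureU2 _ mD mE) _; rewrite lte_add_pinfty.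
have [h [sh _ fh]] := bochner_integrable_approx mDE hf.
have sub A : measurable A -> (mu A < +oo)%E -> A `<=` D `|` E ->
    simple_integral mu A (h n) @[n --> \oo] --> bochner_integral mu A f.
  move=> mA finA ADE; apply: bochner_integral_cvg => //.
    exact: (bochner_integrableS mDE).
  apply: (@squeeze_cvge _ _ _ _ (cst 0%E) _ (fun n =>
    L1norm mu (D `|` E) (fun t => f t - h n t))) => //; last exact: cvg_cst.
  apply: nearW => n; rewrite L1norm_ge0/=.
  have : strongly_measurable mu (D `|` E) (fun t => f t - h n t).
    by apply: strongly_measurableB; [case: hf|exact: strongly_measurable_simple].
  move=> /strongly_measurable_norm[F [mF F0 fF]].
  rewrite (L1norm_measurable F0 fF) (@L1norm_measurable _ _ _ mu A V _ F)//.
    apply: ge0_subset_integral => //; last by move=> t _; rewrite lee_fin.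
    by apply/measurable_EFinP; exact: measurable_funTS.
  by apply: filterS fF => t + /ADE.
have IDE n : simple_integral mu (D `|` E) (h n) =
    simple_integral mu D (h n) + simple_integral mu E (h n).
  have [s [us hs]] : exists s : seq V, uniq s /\ range (h n) `<=` [set` s].
    have [/finite_seqP[s hs] _] := sh n; exists (undup s).
    by rewrite undup_uniq hs; split => // v /=; rewrite mem_undup.
  rewrite !(simple_integral_comp _ _ idfun (sh n) us hs)// -big_split.
  apply: eq_bigr => v _; rewrite /= -scalerDl; congr (_ *: _).
  have mv : measurable (h n @^-1` [set v]) by have [_] := sh n.
  have fin A : measurable A -> A `<=` D `|` E -> mu A \is a fin_num.
    by move=> mA ADE; rewrite ge0_fin_numE//; apply: le_lt_trans finDE;
      apply: le_measure; rewrite ?inE.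
  rewrite setIUl measureUfinl; [|exact: measurableI|exact: measurableI|]; last first.
    by rewrite -ge0_fin_numE// fin//; [exact: measurableI|move=> t [Dt _]; left].
  rewrite [X in (_ - X)%E](_ : _ = 0%E) ?sube0; last first.
    apply: (subset_measure0 _ _ _ DE0); last by move=> t [[Dt _] [Et _]].
      by apply: measurableI; exact: measurableI.
    exact: measurableI.
  rewrite fineD//; apply: fin; try exact: measurableI.
    by move=> t [Dt _]; left.
  by move=> t [Et _]; right.
have Ic := sub _ mDE finDE (@subset_refl _ _).
rewrite (funext IDE) in Ic; apply: (cvg_unique _ Ic) => //.
by apply: cvgD; apply: sub.
Qed.

End integral_operations.

(** * Change of variables and translations *)

Section change_of_variables.
Context {d d' : measure_display} {T : measurableType d} {T' : measurableType d'}.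
Context {R : realType}.
Variables (mu : {measure set T -> \bar R}) (mu' : {measure set T' -> \bar R}).
Variable phi : T' -> T.
Hypotheses (mphi : measurable_fun setT phi)
  (phiE : forall A, measurable A -> mu' (phi @^-1` A) = mu A).

Let measurable_phi A : measurable A -> measurable (phi @^-1` A).
Proof. by move=> mA; rewrite -[X in measurable X]setTI; exact: mphi. Qed.

Lemma ae_precomp (P : T -> Prop) :
  {ae mu, forall t, P t} -> {ae mu', forall t, P (phi t)}.
Proof.
move=> [N [mN N0 PN]]; exists (phi @^-1` N); split; first exact: measurable_phi.
  by rewrite phiE.
by move=> t /= Pt; exact: PN.
Qed.

Lemma strongly_measurable_precomp (V : normedModType R) (D : set T) (f : T -> V) :
  strongly_measurable mu D f ->
  strongly_measurable mu' (phi @^-1` D) (f \o phi).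
Proof.
move=> [h [sh hf]]; exists (fun n => h n \o phi); split.
  by move=> n; exact: simple_fun_precomp.
exact: ae_precomp hf.
Qed.

Lemma L1norm_precomp (V : normedModType R) (D : set T) (f : T -> V) :
  measurable D -> strongly_measurable mu D f ->
  L1norm mu' (phi @^-1` D) (f \o phi) = L1norm mu D f.
Proof.
move=> mD mf; have [F [mF F0 fF]] := strongly_measurable_norm mf.
rewrite (L1norm_measurable F0 fF).
rewrite (@L1norm_measurable _ _ _ mu' _ V (f \o phi) (F \o phi)); last 2 first.
- by move=> t; exact: F0.
- exact: (ae_precomp fF).
have mFD : measurable_fun D (EFin \o F).
  by apply/measurable_EFinP; exact: measurable_funTS.
transitivity (\int[mu']_(t in phi @^-1` D) ((EFin \o F) \o phi) t)%E => //.
rewrite -(ge0_integral_pushforward mphi mu' mD mFD); last first.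
  by move=> t _; rewrite lee_fin.
by apply: eq_measure_integral => A mA AD; exact: phiE.
Qed.

Lemma bochner_integrable_precomp (V : normedModType R) (D : set T) (f : T -> V) :
  measurable D -> bochner_integrable mu D f ->
  bochner_integrable mu' (phi @^-1` D) (f \o phi).
Proof.
move=> mD [mf finf]; split; first exact: strongly_measurable_precomp.
by rewrite L1norm_precomp.
Qed.

Lemma bochner_integral_precomp (V : completeNormedModType R) (D : set T) (f : T -> V) :
  measurable D -> (mu D < +oo)%E -> bochner_integrable mu D f ->
  bochner_integral mu' (phi @^-1` D) (f \o phi) = bochner_integral mu D f.
Proof.
move=> mD finD hf; have [h [sh _ fh]] := bochner_integrable_approx mD hf.
have Ih n : simple_integral mu' (phi @^-1` D) (h n \o phi) =
    simple_integral mu D (h n).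
  rewrite /simple_integral; apply: eq_fsbigr => v _; congr (fine _ *: _).
  by rewrite -phiE//; apply: measurableI => //; have [_] := sh n.
have shphi n : simple_fun (h n \o phi) by exact: simple_fun_precomp.
have finphi : (mu' (phi @^-1` D) < +oo)%E by rewrite phiE.
have := bochner_integral_cvg (measurable_phi mD) finphi
  (bochner_integrable_precomp mD hf) shphi.
rewrite (funext Ih) (_ : (fun n => L1norm _ _ _) =
    (fun n => L1norm mu D (fun t => f t - h n t))); last first.
  apply/funext => n; rewrite -L1norm_precomp//; apply: strongly_measurableB.
    by case: hf.
  exact: strongly_measurable_simple.
move=> /(_ fh) Iphi.
exact: cvg_unique Iphi (bochner_integral_cvg mD finD hf sh fh).
Qed.

End change_of_variables.

Section translation.
Context {R : realType}.
Local Notation mu := (@lebesgue_measure R).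

Lemma measurable_shift (c : R) :
  measurable_fun setT (fun t : measurableTypeR R => t + c : measurableTypeR R).
Proof. exact: measurable_funD. Qed.

(** The image of Lebesgue measure by a translation agrees with Lebesgue measure
    on half-open intervals, which determine it. *)
Lemma lebesgue_measure_shift (c : R) (A : set (measurableTypeR R)) :
  measurable A -> mu ((fun t => t + c) @^-1` A) = mu A.
Proof.
move=> mA; apply/esym.
rewrite (@lebesgue_measure_unique R
  (pushforward mu (fun t : measurableTypeR R => t + c : measurableTypeR R)))//.
- exact: measurable_shift.
move=> mf _ [[a b] _ <-] /=; rewrite /pushforward.
rewrite (_ : _ @^-1` _ = `](a - c), (b - c)]%classic); last first.
  by apply/seteqP; split=> t /=; rewrite !in_itv/= ltrBlDr lerBrDr.
rewrite !lebesgue_measure_itv /= !lte_fin ltrD2r; case: ifPn => // _.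
by rewrite -!EFinB opprB addrA subrK.
Qed.

Lemma preimage_shift_itvcc (a b c : R) :
  (fun t => t + c) @^-1` `[a + c, b + c]%classic = `[a, b]%classic.
Proof. by apply/seteqP; split=> t /=; rewrite !in_itv/= !lerD2r. Qed.

Lemma ae_shift (c : R) (P : R -> Prop) :
  {ae mu, forall t, P t} -> {ae mu, forall t, P (t + c)}.
Proof.
exact: (ae_precomp (measurable_shift c) (lebesgue_measure_shift c)).
Qed.

Lemma lebesgue_measure_itvcc_lty (a b : R) : (mu `[a, b]%classic < +oo)%E.
Proof. by rewrite lebesgue_measure_itv /=; case: ifP => _; rewrite ?ltry. Qed.

Lemma bochner_integrable_shift (V : normedModType R) (a b c : R) (f : R -> V) :
  bochner_integrable mu `[a + c, b + c] f ->
  bochner_integrable mu `[a, b] (fun t => f (t + c)).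
Proof.
rewrite -(preimage_shift_itvcc a b c) => hf.
apply: (bochner_integrable_precomp (measurable_shift c)
  (lebesgue_measure_shift c) (f := f) _ hf).
exact: measurable_itv.
Qed.

Lemma bochner_integral_shift (V : completeNormedModType R) (a b c : R) (f : R -> V) :
  bochner_integrable mu `[a + c, b + c] f ->
  bochner_integral mu `[a, b] (fun t => f (t + c)) =
  bochner_integral mu `[a + c, b + c] f.
Proof.
move=> hf; rewrite -{1}(preimage_shift_itvcc a b c).
apply: (bochner_integral_precomp (measurable_shift c)
  (lebesgue_measure_shift c) (f := f) _ _ hf).
  exact: measurable_itv.
exact: lebesgue_measure_itvcc_lty.
Qed.

Lemma itvccU (a b c : R) : a <= b -> b <= c ->
  `[a, b]%classic `|` `[b, c]%classic = `[a, c]%classic.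
Proof.
move=> ab bc; apply/seteqP; split=> t /=; rewrite !in_itv/=.
  by move=> [/andP[-> tb]|/andP[bt ->]]; rewrite ?(le_trans tb)// (le_trans ab).
by move=> /andP[at_ tc]; have [tb|/ltW bt] := leP t b; [left|right]; apply/andP.
Qed.

Lemma lebesgue_measure_itvccI (a b c : R) : a <= b -> b <= c ->
  mu (`[a, b]%classic `&` `[b, c]%classic) = 0%E.
Proof.
move=> ab bc; rewrite (_ : _ `&` _ = [set b]); first exact: lebesgue_measure_set1.
apply/seteqP; split=> [t|_ ->] /=; rewrite !in_itv/= ?lexx ?ab ?bc//.
by move=> [/andP[_ tb] /andP[bt _]]; apply/eqP; rewrite eq_le tb.
Qed.

Lemma bochner_integrable_itv (V : normedModType R) (a b c e : R) (f : R -> V) :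
  a <= c -> e <= b ->
  bochner_integrable mu `[a, b] f -> bochner_integrable mu `[c, e] f.
Proof.
move=> ac eb; apply: bochner_integrableS; try exact: measurable_itv.
by move=> t /=; rewrite !in_itv/= => /andP[ct te]; rewrite (le_trans ac) ?(le_trans te).
Qed.

Lemma bochner_integral_chasles (V : completeNormedModType R) (a b c : R) (f : R -> V) :
  a <= b -> b <= c -> bochner_integrable mu `[a, c] f ->
  bochner_integral mu `[a, c] f =
  bochner_integral mu `[a, b] f + bochner_integral mu `[b, c] f.
Proof.
move=> ab bc; rewrite -(itvccU ab bc) => hf.
apply: bochner_integral_setU => //; try exact: measurable_itv.
- exact: lebesgue_measure_itvcc_lty.
- exact: lebesgue_measure_itvcc_lty.
- exact: lebesgue_measure_itvccI.
Qed.

End translation.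

(** * Time grids *)

Section grid.
Context {R : realType}.
Local Notation mu := (@lebesgue_measure R).

(** The largest multiple of 1 / (n + 1) below [t], for nonnegative [t].  On a
    bounded interval it takes finitely many values, so that composing with it
    makes a function of time simple. *)
Definition grid (n : nat) (t : R) : R := (Num.truncn (t * n.+1%:R))%:R / n.+1%:R.

Let n1_gt0 (n : nat) : (0 : R) < n.+1%:R. Proof. by rewrite ltr0n. Qed.

Lemma grid_le n t : 0 <= t -> grid n t <= t.
Proof. by move=> t0; rewrite ler_pdivrMr// truncn_le mulr_ge0. Qed.

Lemma lt_grid n t : t < grid n t + n.+1%:R^-1.
Proof.
rewrite /grid -[X in _ + X]mul1r -mulrDl ltr_pdivlMr// natr1.
by rewrite -truncn_le_nat.
Qed.

Lemma grid_cvg t : 0 <= t -> grid n t @[n --> \oo] --> t.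
Proof.
move=> t0; apply/subr_cvg0; apply: (norm_cvgr0 (a := harmonic)); last first.
  exact: cvg_harmonic.
move=> n; rewrite distrC ger0_norm ?subr_ge0 ?grid_le// lerBlDl.
exact/ltW/lt_grid.
Qed.

Lemma simple_fun_grid (V : Type) (phi : R -> V) (v0 : V) (T : R) (n : nat) :
  simple_fun (fun t => if t \in `[0, T]%classic then phi (grid n t) else v0).
Proof.
(* [None] stands for the times outside [0, T]. *)
pose idx (t : measurableTypeR R) : option nat :=
  if t \in `[0, T]%classic then Some (Num.truncn (t * n.+1%:R)) else None.
suff sidx : simple_fun idx.
  rewrite (_ : (fun t => _) = (fun k => if k is Some k then phi (k%:R / n.+1%:R)
    else v0) \o idx); first exact: simple_fun_comp.
  by apply/funext => t /=; rewrite /idx; case: ifP.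
split.
  pose N := Num.truncn (T * n.+1%:R).
  apply: (@sub_finite_set _ _ (None |` (Some @` `I_N.+1))).
    move=> _ [t _ <-]; rewrite /idx; case: ifPn => [/set_mem|_]; last by left.
    rewrite /= in_itv/= => /andP[t0 tT]; right => /=.
    exists (Num.truncn (t * n.+1%:R)) => //=; rewrite ltnS; apply: le_truncn.
    by rewrite ler_wpM2r.
  rewrite finite_setU; split; first exact: finite_set1.
  by apply: finite_image; exact: finite_II.
have mI : measurable (`[0, T]%classic : set (measurableTypeR R)).
  exact: measurable_itv.
move=> [k|].
  rewrite (_ : _ @^-1` _ = `[0, T]%classic `&`
      `[k%:R / n.+1%:R, k.+1%:R / n.+1%:R[%classic).
    by apply: measurableI => //; exact: measurable_itv.
  apply/seteqP; split=> t; rewrite /idx /=.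
    case: ifPn => // /set_mem It [<-]; split => //.
    move: It; rewrite /= !in_itv/= => /andP[t0 _].
    rewrite ler_pdivrMr// ltr_pdivlMr//; apply: truncn_itv.
    by rewrite mulr_ge0.
  move=> [It]; rewrite mem_set// in_itv/= ler_pdivrMr// ltr_pdivlMr// => H.
  by congr Some; exact: truncn_def.
rewrite (_ : _ @^-1` _ = ~` `[0, T]%classic); first exact: measurableC.
apply/seteqP; split=> t; rewrite /idx /=.
  by case: ifPn => // /negP H _ /mem_set.
by move=> H; rewrite memNset.
Qed.

(** The function is sampled at the grid point to the right of [t]. *)
Lemma strongly_measurable_right_continuous (V : normedModType R) (T : R) (f : R -> V) :
  (forall (t : R) (s : nat -> R), 0 <= t -> (forall n, t <= s n) ->
     s n @[n --> \oo] --> t -> f (s n) @[n --> \oo] --> f t) ->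
  strongly_measurable mu `[0, T] f.
Proof.
move=> rcf; exists (fun n t => if t \in `[0, T]%classic then
  f (grid n t + n.+1%:R^-1) else 0); split.
  by move=> n; exact: (simple_fun_grid (fun t => f (t + n.+1%:R^-1))).
apply: aeW => t It; rewrite mem_set//.
move: It; rewrite /= in_itv/= => /andP[t0 _].
apply: rcf => // [n|]; first exact/ltW/lt_grid.
rewrite -[X in _ --> X]addr0; apply: cvgD; first exact: grid_cvg.
exact: cvg_harmonic.
Qed.

End grid.

(** * Evolution families and mild solutions *)

Section shrinking_interval.
Context {R : realType} {V : normedModType R}.
Local Notation mu := (@lebesgue_measure R).

(** Absolute continuity of the integral, for the short interval after a restart of
    the evolution. *)
Lemma L1norm_shrink_cvg0 (f : R -> V) (r b : R) (s : nat -> R) :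
  r < b -> bochner_integrable mu `[r, b] f -> (forall n, r <= s n) ->
  s n @[n --> \oo] --> r -> L1norm mu `[r, s n] f @[n --> \oo] --> 0%E.
Proof.
move=> rb [mf finf] rs sr.
have [F [mF F0 fF]] := strongly_measurable_norm mf.
have mI c : measurable (`[r, c]%classic : set (measurableTypeR R)).
  exact: measurable_itv.
(* Dominated convergence on the fixed interval [r, b]: outside the null set {r}
   the indicators of [r, s n] are eventually 0. *)
pose G n t := F t * \1_(`[r, s n]%classic) t.
have mG n : measurable_fun setT (G n).
  by apply: measurable_funM => //; exact: measurable_indic.
have : (\int[mu]_(t in `[r, b]) (G n t)%:E)%E @[n --> \oo] --> 0%E.
  have := @dominated_convergence _ _ _ mu _ (mI b) (fun n t => (G n t)%:E)
    (cst 0%E) (fun t => (F t)%:E).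
  case => //.
  - by move=> n; apply/measurable_EFinP; exact: measurable_funTS.
  - exists [set r]; split; first exact: measurable_set1.
      exact: lebesgue_measure_set1.
    move=> t /= H; apply: contrapT => tr; apply: H; rewrite in_itv /= => /andP[rt _].
    have {tr}rt' : r < t by rewrite lt_neqAle rt andbT eq_sym; exact/eqP.
    apply: cvg_near_cst; have /cvgr_lt/(_ t rt') := sr; apply: filterS => n st.
    by rewrite /G indicE memNset ?mulr0//= in_itv/= => /andP[_]; rewrite leNgt st.
  - apply/integrableP; split; first by apply/measurable_EFinP; exact: measurable_funTS.
    under eq_integral do rewrite gee0_abs ?lee_fin//.
    by rewrite -(L1norm_measurable F0 fF).
  - apply: aeW => t n _; rewrite gee0_abs ?lee_fin /G indicE.
      by rewrite ler_piMr//; case: (_ \in _).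
    by rewrite mulr_ge0.
  by move=> _ _; rewrite integral0.
apply: cvg_trans; apply: near_eq_cvg.
have /cvgr_lt/(_ b rb) := sr; apply: filterS => n /ltW snb.
rewrite (@L1norm_measurable _ _ _ mu _ V f F)//; last first.
  apply: filterS fF => t fF; rewrite /= in_itv/= => /andP[rt ts]; apply: fF.
  by rewrite /= in_itv/= rt (le_trans ts).
rewrite [LHS]integral_mkcond [RHS]integral_mkcond; apply: eq_integral => t _.
rewrite !patchE /G indicE.
have [tb|tb] := boolP (t \in `[r, b]%classic).
  by case: ifPn => _; rewrite ?mulr1 ?mulr0.
rewrite ifN//; apply: contra tb; rewrite !inE/= !in_itv/= => /andP[-> ts].
by rewrite (le_trans ts).
Qed.

End shrinking_interval.

Section evolution.
Context {R : realType} {X : completeNormedModType R}.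
Local Notation mu := (@lebesgue_measure R).
Variables (UA : R -> R -> X -> X) (M : R).
Hypotheses (hUA : evolution_family UA)
  (UAM : forall t s v, s <= t -> `|UA t s v| <= M * `|v|).

Lemma evolution_bounded_op t s : s <= t -> bounded_op (UA t s).
Proof. by case: hUA => H _ _ _; exact: H. Qed.

Lemma evolutionD t s : s <= t -> {morph UA t s : x y / x + y}.
Proof.
by move=> /evolution_bounded_op/bounded_op_linear[L ->] x y; rewrite linearD.
Qed.

Lemma evolutionB t s : s <= t -> {morph UA t s : x y / x - y}.
Proof.
by move=> /evolution_bounded_op/bounded_op_linear[L ->] x y; rewrite linearB.
Qed.

Lemma evolution_comp t r s x : s <= r -> r <= t -> UA t r (UA r s x) = UA t s x.
Proof. by case: hUA => _ _ H _ sr rt; rewrite -(H t r s sr rt). Qed.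

Lemma evolution_id t x : UA t t x = x.
Proof. by case: hUA => _ -> _ _. Qed.

(** Joint strong continuity is available only within the set s <= t, so the
    approximating times have to stay in it. *)
Lemma evolution_cvg (t s : nat -> R) (a b : R) x :
  (forall n, s n <= t n) -> b <= a ->
  t n @[n --> \oo] --> a -> s n @[n --> \oo] --> b ->
  UA (t n) (s n) x @[n --> \oo] --> UA a b x.
Proof.
move=> st ba ta sb; case: hUA => _ _ _ /(_ x)/subspace_continuousP.
move=> /(_ (a, b) ba) /= H.
apply: (cvg_comp (fun n => (t n, s n)) _ _ H).
move=> A /= wA.
have tsA : \forall n \near \oo, s n <= t n -> A (t n, s n).
  have ts : (t n, s n) @[n --> \oo] --> (a, b) by apply: (cvg_pair ta sb).
  exact: ts wA.
by apply: filterS tsA => n; apply.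
Qed.

(** The kernel is sampled at the grid point to the left of [s], which stays in
    [0, t].  The uniform bound [M] absorbs the error of approximating [f], and
    strong continuity the error of sampling. *)
Lemma strongly_measurable_evolution (t : R) (f : R -> X) :
  strongly_measurable mu `[0, t] f ->
  strongly_measurable mu `[0, t] (fun s => UA t s (f s)).
Proof.
move=> [h [sh hf]].
exists (fun n s => (if s \in `[0, t]%classic then UA t (grid n s) else id) (h n s)).
split.
  move=> n; have sg := simple_fun_grid (UA t) (id : X -> X) t n.
  exact: (simple_fun_comp (fun p => p.1 p.2) (simple_fun_pair sg (sh n))).
apply: filterS hf => s hf Is; rewrite mem_set//.
have /andP[s0 st] : 0 <= s <= t by move: Is; rewrite /= in_itv.
have gt_ n : grid n s <= t by rewrite (le_trans (grid_le _ _)).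
rewrite -[X in _ --> X]add0r.
rewrite (_ : (fun n => _) = (fun n => UA t (grid n s) (h n s - f s) +
  UA t (grid n s) (f s))); last by apply/funext => n; rewrite evolutionB// subrK.
apply: cvgD; last by apply: evolution_cvg => //; [exact: cvg_cst|exact: grid_cvg].
apply: (norm_cvgr0 (a := fun n => M * `|h n s - f s|)); first by move=> n; exact: UAM.
rewrite -(mulr0 M); apply: cvgM; first exact: cvg_cst.
rewrite -(normr0 X); apply: cvg_norm; rewrite -(subrr (f s)).
by apply: cvgB; [exact: hf|exact: cvg_cst].
Qed.

Hypothesis M0 : 0 <= M.

Lemma bochner_integrable_evolution (r t : R) (f : R -> X) : 0 <= r ->
  bochner_integrable mu `[0, t] f ->
  bochner_integrable mu `[r, t] (fun s => UA t s (f s)).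
Proof.
move=> r0 hf; apply: (@bochner_integrable_itv _ _ 0 t) => //.
have mI : measurable (`[0, t]%classic : set (measurableTypeR R)).
  exact: measurable_itv.
apply: (bochner_integrable_dominated mI M0 _ hf).
  by apply: aeW => s; rewrite /= in_itv/= => /andP[_ st]; exact: UAM.
by apply: strongly_measurable_evolution; case: hf.
Qed.

Section variation_of_constants.
Variable f : R -> X.
Hypothesis hf : forall t, bochner_integrable mu `[0, t] f.

Definition forced_state (t : R) : X :=
  bochner_integral mu `[0, t] (fun s => UA t s (f s)).

Definition mild (x : X) (t : R) : X := UA t 0 x + forced_state t.

(** U_A(t, s) factors through time [r] when s <= r, so the forcing before [r]
    acts after [r] only through the state at [r]. *)
Lemma mild_split x r t : 0 <= r -> r <= t ->
  mild x t = UA t r (mild x r) + bochner_integral mu `[r, t] (fun s => UA t s (f s)).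
Proof.
move=> r0 rt; have t0 := le_trans r0 rt.
have -> : mild x t = UA t 0 x + (UA t r (forced_state r) +
    bochner_integral mu `[r, t] (fun s => UA t s (f s))).
  congr (_ + _); rewrite /forced_state (bochner_integral_chasles r0 rt); last first.
    exact: bochner_integrable_evolution.
  congr (_ + _).
  rewrite -(bochner_integral_op _ _ (evolution_bounded_op rt)).
  - apply: bochner_integral_ae_eq; apply: aeW => s; rewrite /= in_itv/= => /andP[_ sr].
    by rewrite evolution_comp.
  - exact: measurable_itv.
  - exact: lebesgue_measure_itvcc_lty.
  - exact: bochner_integrable_evolution.
by rewrite addrA (evolutionD rt (UA r 0 x) (forced_state r)) (evolution_comp x r0 rt).
Qed.

(** Restarting at [r] leaves an orbit, which is continuous, and the integral of
    the forcing over an interval that shrinks to [r].  From the left this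
    argument would need the orbit of a moving initial state. *)
Lemma mild_right_continuous x (r : R) (s : nat -> R) : 0 <= r ->
  (forall n, r <= s n) -> s n @[n --> \oo] --> r ->
  mild x (s n) @[n --> \oo] --> mild x r.
Proof.
move=> r0 rs sr.
rewrite -[X in _ --> X]addr0 -[X in X + _](evolution_id r).
rewrite (_ : (fun n => _) = (fun n => UA (s n) r (mild x r) +
  bochner_integral mu `[r, s n] (fun u => UA (s n) u (f u)))); last first.
  by apply/funext => n; exact: mild_split.
apply: cvgD; first by apply: evolution_cvg => //; exact: cvg_cst.
have fin : M%:E \is a fin_num by [].
apply: (norm_cvge0 (a := fun n => M%:E * L1norm mu `[r, s n] f)%E); last first.
  rewrite -(mule0 M%:E); apply: cvgeZl => //.
  apply: (@L1norm_shrink_cvg0 _ _ _ _ (r + 1)) => //; first by rewrite ltrDl.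
  exact: (bochner_integrable_itv r0 (lexx _) (hf (r + 1))).
move=> n; have mI : measurable (`[r, s n]%classic : set (measurableTypeR R)).
  exact: measurable_itv.
apply: le_trans (norm_bochner_integral mI (lebesgue_measure_itvcc_lty _ _)
  (bochner_integrable_evolution r0 (hf _))) _.
have [mf _] : bochner_integrable mu `[r, s n] f.
  exact: (bochner_integrable_itv r0 (lexx _) (hf (s n))).
rewrite -[leRHS]add0e.
rewrite (_ : 0%E = L1norm mu `[r, s n] (fun=> 0 : R)); last first.
  by rewrite /L1norm; under eq_integral do rewrite normr0; rewrite integral0.
apply: L1norm_dominated => //.
  by apply: strongly_measurable_simple; exact: simple_fun_cst.
apply: aeW => t; rewrite /= in_itv/= => /andP[_ ts].
by rewrite normr0 add0r; exact: UAM.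
Qed.

End variation_of_constants.
End evolution.

(** * The inverse of I - U_A(tau, 0) *)

Section monodromy.
Context {R : realType} {X : completeNormedModType R}.
Variables (UA : R -> R -> X -> X) (tau M omega : R).
Hypotheses (tau0 : 0 < tau) (M0 : 0 < M) (omega0 : 0 < omega).
Hypotheses (hUA : evolution_family UA) (hper : periodic_family tau UA).
Hypothesis UAM : forall t s v, s <= t ->
  `|UA t s v| <= M * expR (- omega * (t - s)) * `|v|.

Let q : R := expR (- omega * tau).

Let q_gt0 : 0 < q. Proof. exact: expR_gt0. Qed.

Let q_lt1 : q < 1.
Proof. by rewrite expR_lt1 mulNr oppr_lt0 mulr_gt0. Qed.

Lemma evolution_bound t s v : s <= t -> `|UA t s v| <= M * `|v|.
Proof.
move=> st; apply: le_trans (UAM v st) _; rewrite ler_wpM2r// ler_piMr ?(ltW M0)//.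
by rewrite expR_le1 mulNr oppr_le0 mulr_ge0 ?(ltW omega0)// subr_ge0.
Qed.

Lemma evolution_decay n v : `|UA (n%:R * tau) 0 v| <= M * q ^+ n * `|v|.
Proof.
have nt : 0 <= n%:R * tau by rewrite mulr_ge0// ltW.
apply: le_trans (UAM v nt) _; rewrite subr0 /q -expRM_natl.
by rewrite mulrCA.
Qed.

Lemma evolution_cvg0 v : UA (n%:R * tau) 0 v @[n --> \oo] --> 0.
Proof.
apply: (norm_cvgr0 (a := fun n => M * q ^+ n * `|v|)).
  by move=> n; exact: evolution_decay.
rewrite -(mul0r `|v|) -(mulr0 M); apply: cvgM; last exact: cvg_cst.
apply: cvgM; first exact: cvg_cst.
by apply: cvg_expr; rewrite ger0_norm ?ltW.
Qed.

Let Phi := UA tau 0.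

Let Phi_bounded : bounded_op Phi.
Proof. exact: (evolution_bounded_op hUA (ltW tau0)). Qed.

Lemma evolution_shift n t s : s <= t ->
  UA (t + n%:R * tau) (s + n%:R * tau) = UA t s.
Proof.
move=> st; elim: n => [|n IHn]; first by rewrite mul0r !addr0.
by rewrite -natr1 mulrDl mul1r !addrA hper// lerD2r.
Qed.

Let evolution_period n x : UA (n.+1%:R * tau) 0 x = Phi (UA (n%:R * tau) 0 x).
Proof.
have nt : 0 <= n%:R * tau by rewrite mulr_ge0// ltW.
have -> : n.+1%:R * tau = tau + n%:R * tau by rewrite -natr1 mulrDl mul1r addrC.
rewrite -(evolution_comp hUA x nt) ?lerDr ?ltW//.
by have := evolution_shift n (ltW tau0); rewrite add0r => ->.
Qed.

Let K : R := M / (1 - q).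

Let Neumann (x : X) (n : nat) : X := \sum_(k < n) UA (k%:R * tau) 0 x.

(** The tail of the Neumann series is dominated by a geometric series of ratio
    [q]; stating the bound with the difference of two powers makes it
    telescope. *)
Let Neumann_dist x n m :
  `|Neumann x (m + n) - Neumann x n| <= K * `|x| * (q ^+ n - q ^+ (m + n)).
Proof.
elim: m => [|m IHm]; first by rewrite !subrr normr0 mulr0.
rewrite addSn {1}/Neumann big_ord_recr /= -/(Neumann x (m + n)).
rewrite addrAC; apply: le_trans (ler_normD _ _) _.
apply: le_trans (lerD IHm (evolution_decay _ _)) _.
have -> : M * q ^+ (m + n) * `|x| = K * `|x| * (q ^+ (m + n) - q * q ^+ (m + n)).
  by rewrite /K; field; rewrite subr_eq0 gt_eqF.
by rewrite exprS -mulrDr addrA subrK.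
Qed.

Let Neumann_limit x : exists2 y, y - Phi y = x & `|y| <= K * `|x|.
Proof.
have K0 : 0 <= K by rewrite divr_ge0 ?subr_ge0 ?ltW.
have qn_ge0 n : 0 <= q ^+ n by exact: exprn_ge0 (ltW q_gt0).
have qn0 : q ^+ n @[n --> \oo] --> 0.
  by apply: cvg_expr; rewrite ger0_norm ?ltW.
have bnd : K * `|x| * q ^+ n @[n --> \oo] --> 0.
  rewrite -(mulr0 (K * `|x|)); apply: cvgM => //; exact: cvg_cst.
have [y ny] : exists y : X, Neumann x n @[n --> \oo] --> y.
  apply: (cvg_of_cauchy_bound (a := fun n => K * `|x| * q ^+ n)) => //.
  have main n m : (n <= m)%N ->
      `|Neumann x m - Neumann x n| <= K * `|x| * q ^+ n + K * `|x| * q ^+ m.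
    move=> nm; rewrite -(subnK nm); apply: le_trans (Neumann_dist _ _ _) _.
    rewrite mulrBr lerD2l; apply: (@le_trans _ _ 0).
      rewrite oppr_le0; apply: mulr_ge0 => //; exact: mulr_ge0.
    by apply: mulr_ge0 => //; exact: mulr_ge0.
  move=> n m; have [nm|/ltnW mn] := leqP n m; first by rewrite distrC main.
  by rewrite [leRHS]addrC main.
exists y.
  have [_ cPhi] := Phi_bounded.
  have H : Neumann x n - Phi (Neumann x n) @[n --> \oo] --> y - Phi y.
    by apply: cvgB => //; exact: (cvg_comp _ _ ny (cPhi y)).
  have E n : Neumann x n - Phi (Neumann x n) = x - UA (n%:R * tau) 0 x.
    have [L PhiL] := bounded_op_linear Phi_bounded.
    elim: n => [|n IHn].
      by rewrite /Neumann big_ord0 PhiL linear0 mul0r (evolution_id hUA) !subrr.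
    rewrite /Neumann big_ord_recr /= -/(Neumann x n) evolution_period.
    rewrite [in X in _ - X]PhiL linearD -!PhiL opprD addrACA IHn.
    by rewrite addrA subrK.
  rewrite (funext E) in H.
  have H' : x - UA (n%:R * tau) 0 x @[n --> \oo] --> x - 0.
    by apply: cvgB; [exact: cvg_cst|exact: evolution_cvg0].
  by rewrite -[RHS]subr0; exact: cvg_unique H H'.
apply: (ler_cvg_to (cvg_norm ny) (cvg_cst (K * `|x|))); apply: nearW => n.
have := Neumann_dist x 0 n; rewrite addn0 {2}/Neumann big_ord0 subr0 => /le_trans.
apply; rewrite ler_piMr//; first by rewrite mulr_ge0.
by rewrite expr0 gerBl.
Qed.

Let Phi_fixpoint y : y - Phi y = 0 -> y = 0.
Proof.
move=> /eqP; rewrite subr_eq0 => /eqP yE.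
have fixn n : UA (n%:R * tau) 0 y = y.
  by elim: n => [|n IHn]; rewrite ?mul0r ?(evolution_id hUA)// evolution_period IHn.
have := evolution_cvg0 y.
rewrite (funext fixn) => y0; apply: (cvg_unique _ _ y0) => //; exact: cvg_cst.
Qed.

Let subr_Phi_inj : injective (fun x => x - Phi x).
Proof.
have [L PhiL] := bounded_op_linear Phi_bounded.
move=> x y /= xy; apply: subr0_eq; apply: Phi_fixpoint.
transitivity ((x - Phi x) - (y - Phi y)); last by rewrite xy subrr.
by rewrite PhiL linearB !opprB [_ - L x]addrC addrACA [- y + _]addrC.
Qed.

(** The inverse of I - U_A(tau, 0), in the form in which [Green] contains it. *)
Definition resolvent : X -> X := pinv [set: X] (fun x => x - UA tau 0 x).

Lemma resolventP x : resolvent x - UA tau 0 (resolvent x) = x.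
Proof.
have [y yx _] := Neumann_limit x.
have xim : x \in [set y - UA tau 0 y | y in [set: X]] by apply/mem_set; exists y.
exact: (pinvK _ xim).
Qed.

Lemma resolvent_bounded_op : bounded_op resolvent.
Proof.
have [L PhiL] := bounded_op_linear Phi_bounded.
have resolventE y : resolvent (y - Phi y) = y.
  by apply: subr_Phi_inj; exact: resolventP.
apply: (linear_bounded_op (c := K)) => [a x y|x].
  apply: subr_Phi_inj; rewrite /= -/Phi.
  rewrite -[LHS]/(_ - UA tau 0 _) resolventP.
  rewrite PhiL linearP -PhiL opprD addrACA -scalerBr.
  by rewrite !resolventP.
by have [y <- yx] := Neumann_limit x; rewrite resolventE.
Qed.

End monodromy.

(** * The periodic mild solution *)

Section almost_every_time.
Context {R : realType}.
Local Notation mu := (@lebesgue_measure R).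
Implicit Types P Q S : R -> Prop.

Lemma ae_time1 P Q : {ae mu, forall t, P t} -> (forall t, P t -> Q t) ->
  {ae mu, forall t, Q t}.
Proof.
by move=> hP PQ; exact: (@filterS _ _ (ae_filter_ringOfSetsType mu) _ _ PQ hP).
Qed.

Lemma ae_time2 P Q S : {ae mu, forall t, P t} -> {ae mu, forall t, Q t} ->
  (forall t, P t -> Q t -> S t) -> {ae mu, forall t, S t}.
Proof.
move=> hP hQ PQS.
exact: (@filterS2 _ _ (ae_filter_ringOfSetsType mu) _ _ _ PQS hP hQ).
Qed.

Lemma ae_time_forall (P : nat -> R -> Prop) :
  (forall n, {ae mu, forall t, P n t}) -> {ae mu, forall t, forall n, P n t}.
Proof. by move=> hP; exact: (@ae_foralln _ _ _ mu). Qed.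

Lemma ae_neq (a : R) : {ae mu, forall t, t != a}.
Proof.
exists [set a]; split.
- exact: measurable_set1.
- exact: lebesgue_measure_set1.
- by move=> s /= /negP; rewrite negbK => /eqP.
Qed.

End almost_every_time.

Section periodic_mild_state.
Context {R : realType} {X : completeNormedModType R}.
Local Notation mu := (@lebesgue_measure R).
Variables (UA : R -> R -> X -> X) (tau M omega : R).
Hypotheses (tau0 : 0 < tau) (M0 : 0 < M) (omega0 : 0 < omega).
Hypotheses (hUA : evolution_family UA) (hper : periodic_family tau UA).
Hypothesis UAM : forall t s v, s <= t ->
  `|UA t s v| <= M * expR (- omega * (t - s)) * `|v|.

Let UAb := evolution_bound M0 omega0 UAM.

Let integrable_kernel f r t : 0 <= r -> bochner_integrable mu `[0, t] f ->
  bochner_integrable mu `[r, t] (fun s => UA t s (f s)).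
Proof. by move=> r0; exact: (bochner_integrable_evolution hUA UAb (ltW M0)). Qed.

(** The Green kernel at time [t] is the fixed operator
    U_A(t, 0) (I - U_A(tau, 0))^-1 applied to U_A(tau, s), so the operator can be
    taken out of the integral. *)
Lemma bochner_integral_Green (f : R -> X) (t : R) : 0 <= t ->
  bochner_integrable mu `[0, tau] f ->
  bochner_integral mu `[0, tau] (fun s => Green tau UA t s (f s)) =
  UA t 0 (resolvent UA tau (forced_state UA f tau)).
Proof.
move=> t0 hf.
have bF : bounded_op (UA t 0 \o resolvent UA tau).
  apply: bounded_op_comp; first exact: (evolution_bounded_op hUA).
  exact: (resolvent_bounded_op tau0 M0 omega0 hUA hper UAM).
have mI : measurable (`[0, tau]%classic : set (measurableTypeR R)).
  exact: measurable_itv.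
exact: (bochner_integral_op mI (lebesgue_measure_itvcc_lty _ _) bF
  (integrable_kernel (lexx 0) hf)).
Qed.

Lemma forced_stateD (f g : R -> X) (t : R) :
  bochner_integrable mu `[0, t] f -> bochner_integrable mu `[0, t] g ->
  forced_state UA (fun s => f s + g s) t = forced_state UA f t + forced_state UA g t.
Proof.
move=> hf hg.
have mI : measurable (`[0, t]%classic : set (measurableTypeR R)).
  exact: measurable_itv.
rewrite /forced_state -(bochner_integralD mI (lebesgue_measure_itvcc_lty _ _)
  (integrable_kernel (lexx 0) hf) (integrable_kernel (lexx 0) hg)).
apply: bochner_integral_ae_eq; apply: aeW => s; rewrite /= in_itv/= => /andP[_ st].
exact: (evolutionD hUA).
Qed.

Variable f : R -> X.
Hypothesis hf : forall t, bochner_integrable mu `[0, t] f.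

(** The fixed point of the affine map that sends an initial state to the state
    after one period. *)
Definition periodic_initial_state : X := resolvent UA tau (forced_state UA f tau).

Let xi := periodic_initial_state.

Lemma mildB x y t : 0 <= t -> mild UA f x t = UA t 0 (x - y) + mild UA f y t.
Proof. by move=> t0; rewrite /mild addrA (evolutionB hUA)// subrK. Qed.

Hypothesis fper : ae_periodic tau `]0, +oo[ f.

(** The solution is restarted at [tau], where it has come back to [xi], and the
    remaining integral is translated by one period. *)
Lemma mild_periodic t : 0 <= t -> mild UA f xi (t + tau) = mild UA f xi t.
Proof.
move=> t0.
have tau_le : tau <= t + tau by rewrite lerDr.
rewrite (mild_split hUA UAb (ltW M0) hf xi (ltW tau0) tau_le).
have -> : mild UA f xi tau = xi.
  have := resolventP tau0 M0 omega0 hUA hper UAM (forced_state UA f tau).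
  rewrite -[resolvent _ _ _]/xi => E.
  by rewrite /mild -E addrC subrK.
congr (_ + _).
  by have := hper t0; rewrite add0r => ->.
rewrite -{1}[tau]add0r -bochner_integral_shift; last first.
  by rewrite add0r; apply: integrable_kernel => //; exact: ltW.
apply: bochner_integral_ae_eq.
apply: (ae_time2 fper (ae_neq 0)) => s fs s0; rewrite /= in_itv/= => /andP[s_ge0 st].
rewrite hper//; congr (UA t s _); apply: fs.
by rewrite /= in_itv/= andbT lt_neqAle eq_sym s0.
Qed.

Lemma mild_periodicn n t : 0 <= t -> mild UA f xi (n%:R * tau + t) = mild UA f xi t.
Proof.
move=> t0; elim: n => [|n IHn]; first by rewrite mul0r add0r.
have nt0 : 0 <= n%:R * tau + t.
  exact: addr_ge0 (mulr_ge0 (ler0n R n) (ltW tau0)) t0.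
have -> : n.+1%:R * tau + t = n%:R * tau + t + tau.
  by rewrite -natr1 mulrDl mul1r addrAC.
by rewrite (mild_periodic nt0).
Qed.

Lemma mild_decompose x n t : 0 <= t ->
  mild UA f x (n%:R * tau + t) =
  UA (n%:R * tau + t) 0 (x - xi) + mild UA f xi t.
Proof.
move=> t0; rewrite (mildB x xi) ?mild_periodicn//.
by rewrite addr_ge0// mulr_ge0// ltW.
Qed.

End periodic_mild_state.

(** * Square-integrable and periodic functions of time *)

Section square_integrable.
Context {d : measure_display} {T : measurableType d} {R : realType}.
Variable mu : {measure set T -> \bar R}.
Variables (V : normedModType R) (D : set T).
Hypotheses (mD : measurable D) (finD : (mu D < +oo)%E).
Implicit Type f : T -> V.

Let sqr_norm (f : T -> V) (t : T) : R := `|f t| ^+ 2.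

Let L1norm_sqr f : L1norm mu D (sqr_norm f) = (\int[mu]_(t in D) (`|f t| ^+ 2)%:E)%E.
Proof.
by apply: eq_integral => t _; rewrite ger0_norm// exprn_ge0.
Qed.

Lemma L2P f : L2 mu D f <-> strongly_measurable mu D f /\
  bochner_integrable mu D (fun t => `|f t| ^+ 2 : R).
Proof.
rewrite /L2 /L2norm -L1norm_sqr; split=> [[mf ff]|[mf [_ ff]]]; split=> //.
- split; last by apply: lty_poweRy ff; rewrite invr_eq0.
  apply: (strongly_measurable_comp (phi := fun v : V => `|v| ^+ 2 : R)) mf => v.
  have := @norm_continuous _ V v => nc.
  by rewrite /continuous_at; under eq_fun do rewrite expr2; rewrite expr2; exact: cvgM.
- exact: poweR_lty.
Qed.

Lemma L2_bochner_integrable f : L2 mu D f -> bochner_integrable mu D f.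
Proof.
move=> /L2P[mf [mf2 finf2]]; split=> //.
have m1 : strongly_measurable mu D (fun=> 1 : R).
  by apply: strongly_measurable_simple; exact: simple_fun_cst.
apply: (@le_lt_trans _ _ (L1norm mu D (fun=> 1%R : R) +
  1%:E * L1norm mu D (fun t => `|f t| ^+ 2 : R)%R)%E).
  apply: L1norm_dominated => //; apply: aeW => t _.
  rewrite mul1r normr1 [X in _ <= _ + X]ger0_norm ?exprn_ge0//.
  have := sqr_ge0 (`|f t| - 1); nra.
rewrite mul1e lte_add_pinfty//; rewrite /L1norm.
under eq_integral do rewrite normr1.
by rewrite integral_cst// mul1e.
Qed.

End square_integrable.

Section periodicity.
Context {R : realType}.
Local Notation mu := (@lebesgue_measure R).

(** Periodicity holds outside a null set that depends on the period that is
    considered; countably many translates of it still form a null set. *)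
Lemma ae_periodicn (E : Type) (tau : R) (D : set R) (g : R -> E) :
  (forall t, D t -> D (t + tau)) -> ae_periodic tau D g ->
  {ae mu, forall t, forall n : nat, D t -> g (n%:R * tau + t) = g t}.
Proof.
move=> Dtau gper.
have Dn n t : D t -> D (t + n%:R * tau).
  move=> Dt; elim: n => [|n IHn]; first by rewrite mul0r addr0.
  by rewrite -natr1 mulrDl mul1r addrA; exact: Dtau.
have step k : {ae mu, forall t, D (t + k%:R * tau) ->
    g (t + k%:R * tau + tau) = g (t + k%:R * tau)}.
  exact: (ae_shift (k%:R * tau) gper).
apply: (ae_time1 (ae_time_forall step)) => t gt_ n Dt.
elim: n => [|n IHn]; first by rewrite mul0r add0r.
rewrite -IHn -natr1 mulrDl mul1r addrAC [_ + t]addrC; apply: gt_; exact: Dn.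
Qed.

Lemma L2loc_integrable (V : normedModType R) (u : R -> V) : L2loc u ->
  forall t, bochner_integrable mu `[0, t] u.
Proof.
move=> hu t; apply: (@bochner_integrable_itv _ _ 0 (Num.max t 1)) => //.
  by rewrite le_max lexx.
apply: L2_bochner_integrable; first exact: measurable_itv.
  exact: lebesgue_measure_itvcc_lty.
by apply: hu; rewrite lt_max ltr01 orbT.
Qed.

Section extension.
Variables (tau : R) (tau0 : 0 < tau).

Lemma periodic_extension_itv (E : Type) (g : R -> E) (n : nat) (t : R) :
  n%:R * tau <= t -> t < n.+1%:R * tau ->
  periodic_extension tau g t = g (t - n%:R * tau).
Proof.
move=> nt tn; rewrite /periodic_extension (@floor_def _ _ n)//.
rewrite ler_pdivlMr// ltr_pdivrMr// nt /=.
by rewrite intrD -pmulrn natr1.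
Qed.

Lemma periodic_extension_periodic (E : Type) (g : R -> E) (t : R) :
  periodic_extension tau g (t + tau) = periodic_extension tau g t.
Proof.
rewrite /periodic_extension mulrDl divff ?gt_eqF// floorDrz ?rpred1//.
by rewrite floor1 intrD mulrDl mul1r opprD addrACA subrr addr0.
Qed.

(** On each period the extension is a translate of [g], except at the right end
    point. *)
Lemma periodic_extension_integrable (V : normedModType R) (g : R -> V) (n : nat) :
  bochner_integrable mu `[0, tau] g ->
  bochner_integrable mu `[0, n%:R * tau] (periodic_extension tau g).
Proof.
move=> hg.
have piece k : bochner_integrable mu `[k%:R * tau, k.+1%:R * tau]
    (periodic_extension tau g).
  have tauE : k.+1%:R * tau - k%:R * tau = tau.
    by rewrite -natr1 mulrDl mul1r addrC addKr.
  have := @bochner_integrable_shift _ _ (k%:R * tau) (k.+1%:R * tau)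
    (- (k%:R * tau)) g.
  rewrite subrr tauE => /(_ hg); apply: bochner_integrable_ae_eq.
  apply: (ae_time1 (ae_neq (k.+1%:R * tau))) => t tk; rewrite /= in_itv/=.
  move=> /andP[kt tk']; rewrite (periodic_extension_itv _ kt)//.
  by rewrite lt_neqAle tk.
elim: n => [|n IHn].
  apply: bochner_integrable_itv (piece 0%N); rewrite ?mul0r//.
  by rewrite mul1r ltW.
rewrite -(@itvccU _ _ (n%:R * tau)).
- apply: bochner_integrableU => //; exact: measurable_itv.
- by rewrite mulr_ge0// ltW.
- by rewrite ler_pM2r// ler_nat.
Qed.

Lemma periodic_extension_L2loc (V : normedModType R) (g : R -> V) :
  L2 mu `[0, tau] g -> L2loc (periodic_extension tau g).
Proof.
move=> hg a a0.
have mI b : measurable (`[0, b]%classic : set (measurableTypeR R)).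
  exact: measurable_itv.
have fI (b : R) : (mu `[0%R, b]%classic < +oo)%E by exact: lebesgue_measure_itvcc_lty.
have [n an] : exists n : nat, a <= n%:R * tau.
  exists (Num.truncn (a / tau)).+1; rewrite -ler_pdivrMr//.
  by apply/ltW; have /andP[] := truncn_itv (ltW (divr_gt0 a0 tau0)).
have ext (W : normedModType R) (k : R -> W) : bochner_integrable mu `[0, tau] k ->
    bochner_integrable mu `[0, a] (periodic_extension tau k).
  move=> /(periodic_extension_integrable n); exact: bochner_integrable_itv.
apply/L2P => //; split.
  by have [] := ext _ _ (L2_bochner_integrable (mI tau) (fI tau) hg).
have /L2P[_ hg2] := hg.
exact: (ext _ (fun t => `|g t| ^+ 2 : R)).
Qed.

End extension.
End periodicity.

(** * The output in terms of the periodic regime *)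

Section output_decomposition.
Context {R : realType} {X U0 Ud0 Y0 : completeNormedModType R}.
Local Notation mu := (@lebesgue_measure R).
Variables (UA : R -> R -> X -> X) (tau M omega : R).
Hypotheses (tau0 : 0 < tau) (M0 : 0 < M) (omega0 : 0 < omega).
Hypotheses (hUA : evolution_family UA) (hper : periodic_family tau UA).
Hypothesis UAM : forall t s v, s <= t ->
  `|UA t s v| <= M * expR (- omega * (t - s)) * `|v|.
Variables (B : R -> U0 -> X) (Bd : R -> Ud0 -> X)
  (C : R -> X -> Y0) (D : R -> U0 -> Y0).
Hypotheses (hB : Linfty_op mu B) (hBper : ae_periodic tau [set: R] B).
Hypotheses (hBd : Linfty_op mu Bd) (hBdper : ae_periodic tau [set: R] Bd).
Hypotheses (hC : Linfty_op mu C) (hCper : ae_periodic tau [set: R] C).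
Hypotheses (hD : Linfty_op mu D) (hDper : ae_periodic tau [set: R] D).
Variables (u : R -> U0) (w : R -> Ud0).
Hypotheses (hu : forall t, bochner_integrable mu `[0, t] u)
  (huper : ae_periodic tau `]0, +oo[ u).
Hypotheses (hw : forall t, bochner_integrable mu `[0, t] w)
  (hwper : ae_periodic tau `]0, +oo[ w).

Let mI (t : R) : measurable (`[0, t]%classic : set (measurableTypeR R)).
Proof. exact: measurable_itv. Qed.

Let input (s : R) : X := B s (u s) + Bd s (w s).

Let hBu t : bochner_integrable mu `[0, t] (fun s => B s (u s)).
Proof. exact: (bochner_integrable_op (mI t) hB (hu t)). Qed.

Let hBdw t : bochner_integrable mu `[0, t] (fun s => Bd s (w s)).
Proof. exact: (bochner_integrable_op (mI t) hBd (hw t)). Qed.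

Let hinput t : bochner_integrable mu `[0, t] input.
Proof. exact: (bochner_integrableD (mI t) (hBu t) (hBdw t)). Qed.

Let input_periodic : ae_periodic tau `]0, +oo[ input.
Proof.
apply: (ae_time2 (ae_time2 hBper hBdper (fun t a b => conj a b))
  (ae_time2 huper hwper (fun t a b => conj a b))).
by move=> t [Bt Bdt] [ut wt] t0; rewrite /input Bt// Bdt// ut// wt.
Qed.

Let xi := periodic_initial_state UA tau input.

(** The left-hand side P u + P_d w of the regulator equation, which turns out to
    be the output of the periodic mild solution. *)
Definition steady_output (t : R) : Y0 :=
  opP UA tau B C D u t + opPd UA tau Bd C w t.

(** By [bochner_integral_Green] the two Green terms add up to U_A(t, 0) applied
    to the periodic initial state, and the two remaining integrals to the forced
    part of the mild solution. *)
Lemma steady_outputE t : 0 <= t ->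
  steady_output t = C t (mild UA input xi t) + D t (u t).
Proof.
move=> t0; have UAb := evolution_bound M0 omega0 UAM.
have [bC _ _] := hC; have [L CL] := bounded_op_linear (bC t).
have Green_E := bochner_integral_Green tau0 M0 omega0 hUA hper UAM t0.
rewrite /steady_output /opP /opPd !Green_E//.
rewrite -!/(forced_state UA _ t) /mild /xi /periodic_initial_state.
rewrite !(forced_stateD M0 omega0 hUA UAM)//.
have [RL ResE] := bounded_op_linear (resolvent_bounded_op tau0 M0 omega0 hUA hper UAM).
rewrite ResE linearD (evolutionD hUA)// CL !linearD -!addrA; congr (_ + _).
have swap (a b c e : Y0) : a + (e + (b + c)) = b + (a + (c + e)).
  by rewrite !addrA [a + e + b]addrAC [a + b + e + c]addrAC [a + b]addrC.
exact: swap.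
Qed.

(** Beyond [mild_decompose], this uses that C, D and u repeat themselves in every
    period. *)
Lemma output_decomposition (x0 : X) :
  {ae mu, forall t, forall n : nat, 0 < t ->
    output UA B Bd C D x0 u w (n%:R * tau + t) =
    C t (UA (n%:R * tau + t) 0 (x0 - xi)) + steady_output t}.
Proof.
have Cn := ae_periodicn (fun _ _ => I) hCper.
have Dn := ae_periodicn (fun _ _ => I) hDper.
have un : {ae mu, forall t, forall n : nat, `]0, +oo[%classic t -> u (n%:R * tau + t) = u t}.
  apply: ae_periodicn huper => t; rewrite /= !in_itv/= !andbT => t0.
  by rewrite addr_gt0.
apply: (ae_time2 (ae_time2 Cn Dn (fun t a b => conj a b)) un).
move=> t [Ct Dt] ut n t0.
have [bC _ _] := hC; have [L CL] := bounded_op_linear (bC t).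
rewrite /output Ct// Dt// ut; last by rewrite /= in_itv/= t0.
rewrite steady_outputE ?ltW// addrA; congr (_ + _).
rewrite -[mild_state _ _ _ _ _ _ _]/(mild UA input x0 (n%:R * tau + t)).
rewrite (mild_decompose tau0 M0 omega0 hUA hper UAM hinput input_periodic)//.
  by rewrite CL linearD.
exact: ltW.
Qed.

(** The periodic mild solution is continuous from the right, hence strongly
    measurable, and [strongly_measurable_op] carries this over to C z and D u. *)
Lemma strongly_measurable_steady_output : strongly_measurable mu `[0, tau] steady_output.
Proof.
apply: (@strongly_measurable_ae_eq _ _ _ mu _ _
  (fun t => C t (mild UA input xi t) + D t (u t))).
  by apply: aeW => t; rewrite /= in_itv/= => /andP[t0 _]; rewrite steady_outputE.
apply: strongly_measurableD; last first.
  by apply: strongly_measurable_op hD _; case: (hu tau).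
apply: strongly_measurable_op hC _.
apply: strongly_measurable_right_continuous => t s t0 ts st.
by apply: (mild_right_continuous hUA (evolution_bound M0 omega0 UAM) (ltW M0)).
Qed.

End output_decomposition.

(** * The regulator equation and output regulation *)

Section regulation.
Context {R : realType} {X U0 Ud0 Y0 : completeNormedModType R}.
Local Notation mu := (@lebesgue_measure R).
Variables (UA : R -> R -> X -> X) (tau M omega : R).
Hypotheses (tau0 : 0 < tau) (M0 : 0 < M) (omega0 : 0 < omega).
Hypotheses (hUA : evolution_family UA) (hper : periodic_family tau UA).
Hypothesis UAM : forall t s v, s <= t ->
  `|UA t s v| <= M * expR (- omega * (t - s)) * `|v|.
Variables (B : R -> U0 -> X) (Bd : R -> Ud0 -> X)
  (C : R -> X -> Y0) (D : R -> U0 -> Y0).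
Hypotheses (hB : Linfty_op mu B) (hBper : ae_periodic tau [set: R] B).
Hypotheses (hBd : Linfty_op mu Bd) (hBdper : ae_periodic tau [set: R] Bd).
Hypotheses (hC : Linfty_op mu C) (hCper : ae_periodic tau [set: R] C).
Hypotheses (hD : Linfty_op mu D) (hDper : ae_periodic tau [set: R] D).
Variables (u : R -> U0) (w : R -> Ud0).
Hypotheses (hu : forall t, bochner_integrable mu `[0, t] u)
  (huper : ae_periodic tau `]0, +oo[ u).
Hypotheses (hw : forall t, bochner_integrable mu `[0, t] w)
  (hwper : ae_periodic tau `]0, +oo[ w).
Variable yref : R -> Y0.
Hypotheses (hyref : forall t, bochner_integrable mu `[0, t] yref)
  (hyrefper : ae_periodic tau `]0, +oo[ yref).

Let steady := steady_output UA tau B Bd C D u w.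

Lemma regulator_equationE :
  regulator_equation UA tau B Bd C D yref w u <->
  {ae mu, forall t, t \in `[0, tau] -> steady t = yref t}.
Proof.
split=> h; apply: (ae_time1 h) => t ht It; rewrite /steady /steady_output.
  by rewrite ht// subrK.
by rewrite -ht// addrK.
Qed.

Let alpha : R := omega * tau.

(** The constants are found before the initial state, since output regulation
    asks for a bound that is uniform in [x0]. *)
Lemma output_transient : exists K : R, exists xi : X, 0 <= K /\ forall x0,
  {ae mu, forall t, forall n : nat, 0 < t ->
    `|output UA B Bd C D x0 u w (n%:R * tau + t) - steady t| <=
    K * expR (- alpha * n%:R) * `|x0 - xi|}.
Proof.
have [c c0 Cc] := Linfty_op_bound hC.
exists (c * M), (periodic_initial_state UA tau (fun s => B s (u s) + Bd s (w s))).
split=> [|x0]; first by rewrite mulr_ge0// ltW.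
have dec := output_decomposition tau0 M0 omega0 hUA hper UAM hB hBper hBd hBdper
  hC hCper hDper hu huper hw hwper x0.
apply: (ae_time2 dec Cc) => t {}dec {}Cc n t0.
rewrite dec// addrK; apply: le_trans (Cc _) _.
rewrite -!mulrA; apply: ler_wpM2l => //.
have nt0 : 0 <= n%:R * tau + t by rewrite addr_ge0 ?mulr_ge0// ltW.
apply: le_trans (UAM _ nt0) _; rewrite subr0 -!mulrA.
apply: ler_wpM2l; first exact: ltW.
rewrite ler_wpM2r// ler_expR !mulNr lerN2 mulrDr mulrCA mulrC lerDl.
by rewrite mulr_ge0// ltW.
Qed.

Let alpha_gt0 : 0 < alpha. Proof. exact: mulr_gt0. Qed.

Let periodn n : n.+1%:R * tau - n%:R * tau = tau.
Proof. by rewrite -natr1 mulrDl mul1r addrC addKr. Qed.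

(** Under the regulator equation the error is the transient of
    [output_transient], so its square is bounded by a constant on each
    period. *)
Lemma regulator_equation_sufficient :
  regulator_equation UA tau B Bd C D yref w u ->
  solves_output_regulation UA tau B Bd C D yref w u.
Proof.
move=> /regulator_equationE reg.
have [K [xi [K0 trans]]] := output_transient.
pose c := tau * K ^+ 2 * (2 + 2 * `|xi| ^+ 2).
have c0 : 0 <= c.
  by rewrite !mulr_ge0 ?exprn_ge0 ?(ltW tau0)// addr_ge0// mulr_ge0// exprn_ge0.
(* [solves_output_regulation] squares its constant, and c <= (1 + c)^2. *)
exists (1 + c), alpha; split=> //; first by rewrite ltr_wpDr.
move=> x0 n.
pose e := expR (- alpha * n%:R).
have yn : {ae mu, forall t, forall n : nat, `]0, +oo[%classic t ->
    yref (n%:R * tau + t) = yref t}.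
  apply: ae_periodicn hyrefper => t; rewrite /= !in_itv/= !andbT => t0.
  by rewrite addr_gt0.
have bnd : {ae mu, forall t, t \in `[0, tau] -> t != 0 ->
    `|output UA B Bd C D x0 u w (n%:R * tau + t) - yref (n%:R * tau + t)| <=
    K * e * `|x0 - xi|}.
  apply: (ae_time2 (ae_time2 (trans x0) yn (fun t a b => conj a b)) reg).
  move=> t [{}trans {}yn] {}reg It tn0.
  have t0 : 0 < t.
    by move: It; rewrite in_itv/= => /andP[t0 _]; rewrite lt_neqAle eq_sym tn0.
  have -> : yref (n%:R * tau + t) = steady t.
    by rewrite reg//; apply: yn; rewrite /= in_itv/= t0.
  exact: trans.
have bnd' := ae_shift (- (n%:R * tau)) bnd.
apply: (@le_trans _ _ (\int[mu]_(t in `[(n%:R * tau)%R, (n.+1%:R * tau)%R])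
    cst ((K * e * `|x0 - xi|) ^+ 2)%:E t)%E).
  apply: ae_le_integral => [t _|t _|].
  - by rewrite lee_fin exprn_ge0.
  - by rewrite lee_fin exprn_ge0// !mulr_ge0// expR_ge0.
  apply: (ae_time2 bnd' (ae_neq (n%:R * tau))) => t {}bnd tn It.
  rewrite /= lee_fin lerXn2r// ?nnegrE ?mulr_ge0// ?expR_ge0//.
  have := bnd; rewrite subrKC; apply; last by rewrite subr_eq0.
  move: It; rewrite /= !in_itv/= => /andP[nt tn1].
  by rewrite subr_ge0 nt lerBlDr (le_trans tn1)// -natr1 mulrDl mul1r addrC.
rewrite integral_cst; last exact: measurable_itv.
have muI : mu `[n%:R * tau, n.+1%:R * tau]%classic = tau%:E.
  by rewrite lebesgue_measure_itv /= lte_fin ltr_pM2r// ltr_nat ltnSn -EFinB periodn.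
rewrite [X in (_ * X <= _)%E](_ : _ = tau%:E)// -EFinM lee_fin.
have -> : expR (- 2 * alpha * n%:R) = e ^+ 2.
  by rewrite /e -expRM_natl; congr expR; ring.
have e0 : 0 <= e by exact: expR_ge0.
have dist : `|x0 - xi| ^+ 2 <= (2 + 2 * `|xi| ^+ 2) * (`|x0| ^+ 2 + 1).
  have h1 := ler_normB x0 xi.
  have h2 : `|x0 - xi| ^+ 2 <= (`|x0| + `|xi|) ^+ 2.
    by rewrite lerXn2r// nnegrE// addr_ge0.
  apply: le_trans h2 _; have := sqr_ge0 (`|x0| - `|xi|).
  have := mulr_ge0 (sqr_ge0 `|x0|) (sqr_ge0 `|xi|); nra.
apply: (@le_trans _ _ (e ^+ 2 * (c * (`|x0| ^+ 2 + 1)))).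
  rewrite /c !exprMn.
  have -> : K ^+ 2 * e ^+ 2 * `|x0 - xi| ^+ 2 * tau =
    e ^+ 2 * (tau * K ^+ 2) * `|x0 - xi| ^+ 2 by ring.
  have -> : e ^+ 2 * (tau * K ^+ 2 * (2 + 2 * `|xi| ^+ 2) * (`|x0| ^+ 2 + 1)) =
    e ^+ 2 * (tau * K ^+ 2) * ((2 + 2 * `|xi| ^+ 2) * (`|x0| ^+ 2 + 1)) by ring.
  apply: ler_wpM2l => //.
  by rewrite mulr_ge0 ?exprn_ge0// mulr_ge0 ?exprn_ge0// ltW.
rewrite [(1 + c) ^+ 2 * _]mulrC -[leRHS]mulrA.
apply: ler_wpM2l; first exact: exprn_ge0.
by apply: ler_wpM2r; [rewrite addr_ge0// exprn_ge0|nra].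
Qed.

(** If the defect P u + P_d w - yref had norm above some [del] > 0 on a set [A] of
    positive measure, then the error would have norm above [del] / 2 there once the
    transient is below [del] / 2, and its L^2 norm would stay away from 0.
    Testing on [A] requires only monotonicity of the integral of the squared
    error. *)
Lemma regulator_equation_necessary (x0 : X) :
  L2norm mu `[0, tau]
    (fun t => output UA B Bd C D x0 u w (n%:R * tau + t) - yref t)
    @[n --> \oo] --> 0%E ->
  regulator_equation UA tau B Bd C D yref w u.
Proof.
move=> y0; apply/regulator_equationE.
have [K [xi [K0 /(_ x0) trans]]] := output_transient.
have mI : measurable (`[0, tau]%classic : set (measurableTypeR R)).
  exact: measurable_itv.
have me : strongly_measurable mu `[0, tau] (fun t => steady t - yref t).
  apply: strongly_measurableB; last by case: (hyref tau).
  exact: (strongly_measurable_steady_output tau0 M0 omega0 hUA hper UAM hB hBd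
    hC hD hu hw).
have [g [mg g0 eg]] := strongly_measurable_norm me.
have small (k : nat) : mu (`[0, tau]%classic `&` [set t | k.+1%:R^-1 < g t]) = 0%E.
  set A := _ `&` _; pose del : R := k.+1%:R^-1.
  have del0 : 0 < del by rewrite invr_gt0.
  have mA : measurable (A : set (measurableTypeR R)).
    apply: measurableI => //; rewrite -[X in measurable X]setTI.
    exact: measurable_fun_ltr.
  apply/eqP; rewrite eq_le measure_ge0 andbT leNgt; apply/negP => A0.
  pose kap := (((del / 2) ^+ 2)%:E * mu A)%E.
  have kap0 : (0 < kap)%E by rewrite mule_gt0// lte_fin exprn_gt0// divr_gt0.
  (* From some period on, the transient is below [del] / 2. *)
  have tail : \forall n \near \oo, K * expR (- alpha * n%:R) * `|x0 - xi| < del / 2.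
    have : K * expR (- alpha * n%:R) * `|x0 - xi| @[n --> \oo] --> 0.
      rewrite -(mul0r `|x0 - xi|) -(mulr0 K); apply: cvgM; last exact: cvg_cst.
      apply: cvgM; first exact: cvg_cst.
      under eq_fun do rewrite expRM_natr.
      apply: cvg_expr; rewrite ger0_norm ?expR_ge0//.
      by rewrite expR_lt1 oppr_lt0.
    by move=> /cvgr_lt; apply; rewrite divr_gt0.
  suff : (kap `^ 2^-1 <= 0)%E by rewrite leNgt poweR_gt0.
  apply: (cvge_ge _ y0); apply: filterS tail => n tail.
  rewrite /L2norm; apply: gt0_ler_poweR; rewrite ?invr_ge0//.
  - by rewrite in_itv/= leey (ltW kap0).
  - by rewrite in_itv/= leey andbT integral_ge0// => t _; rewrite lee_fin exprn_ge0.
  rewrite /kap -integral_cst// [leLHS]integral_mkcond [leRHS]integral_mkcond.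
  have out0 t : (0 <= (`|output UA B Bd C D x0 u w (n%:R * tau + t) - yref t| ^+ 2)%:E)%E.
    by rewrite lee_fin exprn_ge0.
  apply: ae_le_integral => [t _|t _|].
  - by rewrite patchE; case: ifP => // _; rewrite lee_fin exprn_ge0// ltW// divr_gt0.
  - by rewrite patchE; case: ifP.
  apply: (ae_time2 (ae_time2 trans eg (fun t a b => conj a b)) (ae_neq 0)).
  move=> t [{}trans {}eg] t0 _; rewrite !patchE.
  case: ifPn => [/set_mem[It]|_]; last by case: ifP.
  rewrite mem_set//= lee_fin => delg.
  rewrite lerXn2r// ?nnegrE// ?(ltW (divr_gt0 del0 _))//.
  have t_gt0 : 0 < t.
    by move: It; rewrite /= in_itv/= => /andP[t_ge0 _]; rewrite lt_neqAle eq_sym t0.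
  have dg : del < `|steady t - yref t| by rewrite eg.
  have := le_lt_trans (trans n t_gt0) tail.
  have := ler_normB (output UA B Bd C D x0 u w (n%:R * tau + t) - yref t)
    (output UA B Bd C D x0 u w (n%:R * tau + t) - steady t).
  rewrite opprB addrC addrA subrK => h1 h2.
  have := lt_le_trans dg h1; move: h2; lra.
have small' (k : nat) : {ae mu, forall t, t \in `[0, tau] -> g t <= k.+1%:R^-1}.
  exists (`[0, tau]%classic `&` [set t | k.+1%:R^-1 < g t]); split => //.
    apply: measurableI => //; rewrite -[X in measurable X]setTI.
    exact: measurable_fun_ltr.
  by move=> t /= /not_implyP[It /negP]; rewrite -ltNge => gt_; split.
apply: (ae_time2 (ae_time_forall small') eg) => t {}small {}eg It.
apply/eqP; rewrite -subr_eq0 -normr_le0 eg//.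
apply: (ler_cvg_to (cvg_cst (g t)) (@cvg_harmonic R)).
by apply: nearW => k; exact: small.
Qed.

End regulation.

Section regulator_equation_ae.
Context {R : realType} {X U0 Ud0 Y0 : completeNormedModType R}.
Local Notation mu := (@lebesgue_measure R).

(** The periodic extension of a control on [0, tau] may differ from it at
    [tau]. *)
Lemma regulator_equation_ae_eq (UA : R -> R -> X -> X) (tau : R)
    (B : R -> U0 -> X) (Bd : R -> Ud0 -> X) (C : R -> X -> Y0) (D : R -> U0 -> Y0)
    (yref : R -> Y0) (w : R -> Ud0) (u v : R -> U0) :
  {ae mu, forall t, t \in `[0, tau] -> u t = v t} ->
  regulator_equation UA tau B Bd C D yref w u ->
  regulator_equation UA tau B Bd C D yref w v.
Proof.
move=> uv reg; apply: (ae_time2 uv reg) => t uvt {}reg It.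
have t_tau : t <= tau by move: It; rewrite in_itv/= => /andP[].
have Green_uv : bochner_integral mu `[0, tau]
    (fun s => Green tau UA t s (B s (v s))) =
    bochner_integral mu `[0, tau] (fun s => Green tau UA t s (B s (u s))).
  by apply: bochner_integral_ae_eq; apply: (ae_time1 uv) => s uvs Is; rewrite uvs.
have UA_uv : bochner_integral mu `[0, t] (fun s => UA t s (B s (v s))) =
    bochner_integral mu `[0, t] (fun s => UA t s (B s (u s))).
  apply: bochner_integral_ae_eq; apply: (ae_time1 uv) => s uvs.
  rewrite /= in_itv/= => /andP[s0 st]; rewrite uvs// in_itv/= s0.
  exact: le_trans st t_tau.
by apply: etrans (reg It); rewrite /opP Green_uv UA_uv (uvt It).
Qed.

End regulator_equation_ae.

Theorem theorem3p1 (R : realType) (tau : R) (htau : 0 < tau)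
    (X U0 Ud0 Y0 : completeNormedModType R)
    (hU0 : hilbert U0) (hUd0 : hilbert Ud0) (hY0 : hilbert Y0)
    (UA : R -> R -> X -> X) (B : R -> U0 -> X) (Bd : R -> Ud0 -> X)
    (C : R -> X -> Y0) (D : R -> U0 -> Y0)
    (hUA : evolution_family UA) (hUAper : periodic_family tau UA)
    (hB : Linfty_op lebesgue_measure B) (hBper : ae_periodic tau [set: R] B)
    (hBd : Linfty_op lebesgue_measure Bd) (hBdper : ae_periodic tau [set: R] Bd)
    (hC : Linfty_op lebesgue_measure C) (hCper : ae_periodic tau [set: R] C)
    (hD : Linfty_op lebesgue_measure D) (hDper : ae_periodic tau [set: R] D)
    (hstable : exponentially_stable UA)
    (yref : R -> Y0) (hyref : L2loc yref)
    (hyrefper : ae_periodic tau `]0, +oo[ yref)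
    (wdist : R -> Ud0) (hwdist : L2loc wdist)
    (hwdistper : ae_periodic tau `]0, +oo[ wdist) :
  (forall ureg : R -> U0, L2 lebesgue_measure `[0, tau] ureg ->
     regulator_equation UA tau B Bd C D yref wdist ureg ->
     L2loc (periodic_extension tau ureg) /\
     solves_output_regulation UA tau B Bd C D yref wdist
       (periodic_extension tau ureg)) /\
  (forall (ureg : R -> U0) (x0 : X), L2loc ureg ->
     ae_periodic tau `]0, +oo[ ureg ->
     L2norm lebesgue_measure `[0, tau]
       (fun t => output UA B Bd C D x0 ureg wdist (n%:R * tau + t) - yref t)
       @[n --> \oo] --> 0%E ->
     regulator_equation UA tau B Bd C D yref wdist ureg).
Proof.
have [M [omega [M0 omega0 stable]]] := hstable.
have UAM t s v : s <= t -> `|UA t s v| <= M * expR (- omega * (t - s)) * `|v|.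
  move=> st; apply: le_trans (le_opnorm _ (evolution_bounded_op hUA st)) _.
  by rewrite ler_wpM2r// stable.
have hw := L2loc_integrable hwdist; have hy := L2loc_integrable hyref.
split=> [ureg hureg regu|ureg x0 hureg uregper].
  have hext := periodic_extension_L2loc htau hureg; split => //.
  have hu := L2loc_integrable hext.
  have huper : ae_periodic tau `]0, +oo[ (periodic_extension tau ureg).
    by apply: aeW => t _; exact: periodic_extension_periodic.
  apply: (regulator_equation_sufficient htau M0 omega0 hUA hUAper UAM) => //.
  apply: regulator_equation_ae_eq regu.
  apply: (ae_time1 (ae_neq tau)) => t tn; rewrite in_itv/= => /andP[t0 tt].
  rewrite (@periodic_extension_itv _ _ htau _ _ 0%N) ?mul0r ?subr0//.
  by rewrite mul1r lt_neqAle tn.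
exact: (regulator_equation_necessary htau M0 omega0 hUA hUAper UAM hB hBper
  hBd hBdper hC hCper hD hDper (L2loc_integrable hureg) uregper hw hwdistper).
Qed.
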